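(* The condition number $\kappa(\mathcal A_{\mathrm{DD}})$ of the domain decomposition system is bounded as $$\kappa(\mathcal A_{\mathrm{DD}})\lesssim 6(1+\tau\alpha_\gamma)^2\max\big(1+C_{\mathrm{inv}}c_{\mathbf K,\gamma}\tau h^{-2},\;1+\alpha_\gamma\tau\big).$$ Furthermore, if $\alpha_\gamma\to\infty$ (the case of continuous pressure across $\gamma$), $$\kappa(\mathcal A_{\mathrm{DD}})\lesssim 6\big(1+C_{\mathrm{dTr}}^2c_{\mathbf K}^{-1}\tau h^{-1}\big)^2\max\big(1+C_{\mathrm{inv}}c_{\mathbf K,\gamma}\tau h^{-2},\;1+C_{\mathrm{dTr}}^2c_{\mathbf K}^{-1}\tau h^{-1}\big).$$
   Context: Geometry: $\Omega\subset\mathbb R^d$, $d\in\{2,3\}$, is a bounded domain with Lipschitz boundary; $\gamma\subset\Omega$ is a $(d-1)$-dimensional non self-intersecting surface of class $C^2$ (the fracture) dividing $\Omega$ into two subdomains, $\Omega=\Omega_1\cup\Omega_2\cup\gamma$, $\gamma=\partial\Omega_1\cap\partial\Omega_2$; $\mathbf n_i$ is the outward unit normal to $\partial\Omega_i$; $\nabla_\tau\cdot$ is the tangential divergence on $\gamma$. $(\cdot,\cdot)_D$ and $\|\cdot\|_D$ are the $L^2(D)$ scalar product and norm. Data: the conductivity tensors $\mathbf K$ on $\Omega_1\cup\Omega_2$ and $\mathbf K_\gamma$ on $\gamma$ are time independent and satisfy $\zeta^{T}\mathbf K^{-1}\zeta\ge c_{\mathbf K}|\zeta|^2$, $|\mathbf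 K^{-1}\zeta|\le C_{\mathbf K}|\zeta|$ ($\zeta\in\mathbb R^d$) and $\zeta^{T}\mathbf K_\gamma^{-1}\zeta\ge c_{\mathbf K,\gamma}|\zeta|^2$, $|\mathbf K_\gamma^{-1}\zeta|\le C_{\mathbf K,\gamma}|\zeta|$ ($\zeta\in\mathbb R^{d-1}$) a.e., with $c_{\mathbf K},c_{\mathbf K,\gamma}>0$. The Robin parameter $\alpha_\gamma>0$ is a constant. $\tau>0$ is the time step and $L_\gamma>0$ a stabilization parameter. Discretization: $\mathcal T_{h,i}$ is a partition of $\Omega_i$ into simplices or rectangular elements such that $\mathcal T_h=\mathcal T_{h,1}\cup\mathcal T_{h,2}$ is a conforming, quasi-uniform mesh of $\Omega$; $\mathcal T_{h,\gamma}$ is a partition of $\gamma$ induced by $\mathcal T_h$ or slightly coarser; $h$ is the maximal mesh size of both. $M_{h,i}$, $M_{h,\gamma}$ are the piecewise constant functions on $\mathcal T_{h,i}$, $\mathcal T_{h,\gamma}$; $\mathbf V_{h,i}$, $\mathbf V_{h,\gamma}\subset\mathbf H(\mathrm{div}_\tau,\gamma)$ are the lowest-order Raviart–Thomas–Nédélec spaces on $\mathcal T_{h,i}$, $\mathcal T_{h,\gamma}$. With $\mathcal Q_{h,i}$ the $L^2$-projection onto $\mathbf V_{h,i}\cdot\mathbf n_i$, the meshes are such that $\|\lambda\|_\gamma\lesssim\|\mathcal Q_{h,1}\lambda\|_\gamma+\|\mathcal Q_{h,2}\lambda\|_\gamma$ for all $\lambda\in M_{h,\gamma}$. $C_{\mathrm{dTr}},C_{\mathrm{inv}}>0$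 depend only on mesh shape regularity and are the constants in $\|\mathbf u_h\cdot\mathbf n\|_{\partial\Omega_i}\le C_{\mathrm{dTr}}h^{-1/2}\|\mathbf u_h\|_{\Omega_i}$ for $\mathbf u_h\in\mathbf V_{h,i}$ and $\|\nabla_\tau\cdot\mathbf u_{h,\gamma}\|_\gamma\le C_{\mathrm{inv}}h^{-1}\|\mathbf u_{h,\gamma}\|_\gamma$ for $\mathbf u_{h,\gamma}\in\mathbf V_{h,\gamma}$. Forms: $a_i(\mathbf u,\mathbf v)=(\mathbf K^{-1}\mathbf u,\mathbf v)_{\Omega_i}+\alpha_\gamma^{-1}(\mathbf u\cdot\mathbf n_i,\mathbf v\cdot\mathbf n_i)_\gamma$, $b_i(\mathbf u,q)=(\nabla\cdot\mathbf u,q)_{\Omega_i}$, $c_i(p,q)=(p,q)_{\Omega_i}$; $a_\gamma(\mathbf u,\mathbf v)=(\mathbf K_\gamma^{-1}\mathbf u,\mathbf v)_\gamma$, $b_\gamma(\mathbf u,\mu)=(\nabla_\tau\cdot\mathbf u,\mu)_\gamma$. The case ''$\alpha_\gamma\to\infty$'' (continuous pressure) means $a_i(\mathbf u,\mathbf v)=(\mathbf K^{-1}\mathbf u,\mathbf v)_{\Omega_i}$. Interface form: for $\lambda\in M_{h,\gamma}$ let $(\mathbf u^*_{h,i}(\lambda),p^*_{h,i}(\lambda))\in\mathbf V_{h,i}\times M_{h,i}$ solve $a_i(\mathbf u^*_{h,i}(\lambda),\mathbf v)-b_i(\mathbf v,p^*_{h,i}(\lambda))=-(\lambda,\mathbf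 v\cdot\mathbf n_i)_\gamma$ for all $\mathbf v\in\mathbf V_{h,i}$ and $c_i(p^*_{h,i}(\lambda),q)+\tau\, b_i(\mathbf u^*_{h,i}(\lambda),q)=0$ for all $q\in M_{h,i}$. Then $s_\gamma(\lambda,\mu)=-\sum_{i=1}^2(\mathbf u^*_{h,i}(\lambda)\cdot\mathbf n_i,\mu)_\gamma$. Linearized fracture form: $\mathcal A_\gamma((\mathbf u,\lambda),(\mathbf v,\mu))=a_\gamma(\mathbf u,\mathbf v)+L_\gamma(\mathbf u,\mathbf v)_\gamma+\tau^{-1}(\lambda,\mu)_\gamma+b_\gamma(\mathbf u,\mu)-b_\gamma(\mathbf v,\lambda)$. Stiffness matrix and condition number: let $N=\dim(\mathbf V_{h,\gamma}\times M_{h,\gamma})$, fix a basis, and let $V,W\in\mathbb R^N$ be the coordinate vectors of $(\mathbf u,\lambda)$, $(\mathbf v,\mu)$. With $(V,W)_N=\sum_{i=1}^NV_iW_i$ and $|V|_N^2=(V,V)_N$, the matrix $\mathcal A_{\mathrm{DD}}$ is defined by $(\mathcal A_{\mathrm{DD}}V,W)_N=\mathcal A_\gamma((\mathbf u,\lambda),(\mathbf v,\mu))+s_\gamma(\lambda,\mu)$. For a matrix $A$, $|A|_N=\sup_{V\ne0}\sup_{W\neq0}\frac{(AV,W)_N}{|V|_N|W|_N}$, and $\kappa(\mathcal A_{\mathrm{DD}})=|\mathcal A_{\mathrm{DD}}|_N\,|\mathcal A_{\mathrm{DD}}^{-1}|_N$. With $\|(\mathbf v,\mu)\|_{0,\tau,\star}^2=\|\mathbf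 K_\gamma^{-1/2}\mathbf v\|_\gamma^2+\|L_\gamma^{1/2}\mathbf v\|_\gamma^2+\|\tau^{-1/2}\mu\|_\gamma^2$, it is taken as known that there are $c_\mu,C_\mu>0$ with $c_\mu h^{d/2}|V|_N\le\|(\mathbf u,\lambda)\|_{0,\tau,\star}\le C_\mu h^{d/2}|V|_N$ for all $V$. The notation $a\lesssim b$ means $a\le Cb$ with a constant $C>0$ independent of $h$, $\tau$ and $\alpha_\gamma$, the equivalence constants $c_\mu,C_\mu$ being regarded as fixed. *)

(* Defs.v *)
From HB Require Import structures.
From mathcomp Require Import all_boot all_order all_algebra.
From mathcomp Require Import all_classical all_reals all_analysis.
Set Implicit Arguments.
Unset Strict Implicit.
Unset Printing Implicit Defensive.
Import Order.TTheory GRing.Theory Num.Theory.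
Import numFieldNormedType.Exports.
Local Open Scope classical_set_scope.
Local Open Scope ring_scope.

(* Outer measure obtained from countable coverings by the sets S i of weight g i *)
Section method_one.
Local Open Scope ereal_scope.
Context {R : realType} {T I : Type}.
Implicit Types (S : I -> set T) (g : I -> \bar R) (A B : set T).

Definition cover_inf S g A : \bar R :=
  ereal_inf [set \sum_(k <oo) g (c k) |
    c in [set c : nat -> I | A `<=` \bigcup_k S (c k)]].

Lemma cover_inf_ge0 S g A : (forall i, 0 <= g i) -> 0 <= cover_inf S g A.
Proof.
move=> g0; apply: le_ereal_inf_tmp => _ [c _ <-].
by apply: nneseries_ge0 => *; exact: g0.
Qed.

Lemma le_cover_inf S g : {homo cover_inf S g : A B / A `<=` B >-> A <= B}.
Proof.
move=> A B AB; apply: ereal_inf_le_tmp => _ [c Bc <-].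
by exists c => //; exact: subset_trans Bc.
Qed.

Lemma cover_inf0 S g : (forall i, 0 <= g i) -> (exists i, g i = 0) ->
  cover_inf S g set0 = 0.
Proof.
move=> g0 [i gi]; apply/eqP; rewrite eq_le cover_inf_ge0// andbT.
apply: ereal_inf_lbound; exists (fun=> i) => //.
by rewrite eseries0.
Qed.

Lemma cover_inf_sigma_subadditive S g : (forall i, 0 <= g i) ->
  sigma_subadditive (cover_inf S g).
Proof.
move=> g0 A; have [[i ioo]|] := pselect (exists i, cover_inf S g (A i) = +oo).
  rewrite (eseries_pinfty _ _ ioo) ?leey// => n _.
  by rewrite -ltNye (lt_le_trans _ (cover_inf_ge0 _ _ _)).
rewrite -forallNE => Aoo.
suff add2e (e : {posnum R}) : cover_inf S g (\bigcup_n A n) <=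
    \sum_(i <oo) cover_inf S g (A i) + e%:num%:E.
  by apply/lee_addgt0Pr => _/posnumP[].
rewrite (le_trans _ (epsilon_trick _ _ _))//; last first.
  by move=> n; exact: cover_inf_ge0.
pose P n (c : nat -> I) := A n `<=` \bigcup_k S (c k) /\
  \sum_(k <oo) g (c k) <= cover_inf S g (A n) + (e%:num / (2 ^ n.+1)%:R)%:E.
have [G PG] : {G : nat -> nat -> I & forall n, P n (G n)}.
  apply: (@choice _ _ P) => n; rewrite /P /cover_inf.
  set X := (X in ereal_inf X); move infX : (ereal_inf X) => iX.
  case: iX infX => [r Xr|Xoo|Xoo].
  - have en1 : (0 < e%:num / (2 ^ n.+1)%:R)%R by [].
    have /(lb_ereal_inf_adherent en1) : ereal_inf X \is a fin_num by rewrite Xr.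
    move=> [x [c Ac gx] xX].
    by exists c; split => //; rewrite gx -Xr; exact/ltW.
  - by have := Aoo n; rewrite /cover_inf Xoo.
  - suff : lbound X 0 by move/le_ereal_inf_tmp; rewrite Xoo.
    by move=> /= _ [c _ <-]; exact: nneseries_ge0.
have gG_ge0 x : 0 <= (g \o uncurry G) x by exact: g0.
apply: (@le_trans _ _ (\esum_(i in setT) (g \o uncurry G) i)).
  rewrite /cover_inf; apply: ereal_inf_lbound => /=.
  have /card_esym/ppcard_eqP[f] := card_nat2.
  exists (uncurry G \o f).
    apply: (@subset_trans _ (\bigcup_n \bigcup_k S (G n k))) => [t [i _]|].
      by move=> /(PG i).1 -[j _ ?]; exists i => //; exists j.
    move=> t [i _ [j _ Bijt]]; exists (f^-1%FUN (i, j)) => //=.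
    by rewrite invK ?inE.
  rewrite -(esum_pred_image (g \o uncurry G) _ xpredT) ?[fun=> _]set_true//.
  by rewrite image_eq.
rewrite (_ : esum _ _ = \sum_(i <oo) \sum_(j <oo ) g (G i j)); last first.
  pose J : nat -> set (nat * nat) := fun i => [set (i, j) | j in setT].
  rewrite (_ : setT = \bigcup_k J k); last first.
    by rewrite predeqE => -[a b]; split => // _; exists a => //; exists b.
  rewrite esum_bigcupT /=; last 2 first.
    - apply/trivIsetP => i j _ _ ij.
      rewrite predeqE => -[n m] /=; split => //= -[] [_] _ [<-{n} _].
      by move=> [m' _] [] /esym/eqP; rewrite (negbTE ij).
    - by move=> /= [n m]; exact: g0.
  rewrite -(image_id [set: nat]) -fun_true esum_pred_image//; last first.
    by move=> n _; exact: esum_ge0.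
  apply: eq_eseriesr => /= j _.
  rewrite -(esum_pred_image (g \o uncurry G) (pair j) predT)//=; last first.
    by move=> ? ? _ _; exact: (@can_inj _ _ _ snd).
  by congr esum; rewrite predeqE => -[a b]; split; move=> [i _ <-]; exists i.
apply: lee_lim.
- apply: is_cvg_nneseries => n *.
  by apply: nneseries_ge0 => m *; exact: (gG_ge0 (n, m)).
- by apply: is_cvg_nneseries => n *; apply: adde_ge0 => //; exact: cover_inf_ge0.
- by near=> n; apply: lee_sum => i _; exact: (PG i).2.
Unshelve. all: by end_near. Qed.

End method_one.

Section euclidean.
Context {R : realType}.

Definition edot m n (A B : 'M[R]_(m, n)) : R := \sum_i \sum_j A i j * B i j.
Definition enorm m n (A : 'M[R]_(m, n)) : R := Num.sqrt (edot A A).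

Definition cdiam d (A : set 'rV[R]_d) : R :=
  sup [set enorm (x - y) | x in A & y in A].

(* eta^T M^-1 zeta, points and vectors of R^k being rows *)
Definition inv_form k (M : 'M[R]_k) (zeta eta : 'rV[R]_k) : R :=
  edot (invmx M *m zeta^T) eta^T.

Definition boundary d (D : set 'rV[R]_d) : set 'rV[R]_d :=
  closure D `&` closure (~` D).

End euclidean.

Section lebesgue.
Local Open Scope ereal_scope.
Context {R : realType} (d : nat).

Definition box (ab : 'rV[R]_d.+1 * 'rV[R]_d.+1) : set 'rV[R]_d.+1 :=
  [set x | forall i, (ab.1 0%R i <= x 0%R i <= ab.2 0%R i)%R].
Definition box_vol (ab : 'rV[R]_d.+1 * 'rV[R]_d.+1) : \bar R :=
  (\prod_i Num.max (ab.2 0 i - ab.1 0 i) 0)%R%:E.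

Definition leb_outer : set 'rV[R]_d.+1 -> \bar R := cover_inf box box_vol.

Let box_vol_ge0 ab : 0 <= box_vol ab.
Proof. by rewrite lee_fin; apply: prodr_ge0 => i _; rewrite le_max lexx orbT. Qed.

Let box_vol0 : exists ab, box_vol ab = 0.
Proof.
exists (0%R, 0%R); congr _%:E; rewrite big_ord_recl/=.
by rewrite subrr maxxx mul0r.
Qed.

HB.instance Definition _ := isOuterMeasure.Build R _ leb_outer
  (cover_inf0 box box_vol_ge0 box_vol0)
  (fun A => cover_inf_ge0 box A box_vol_ge0)
  (@le_cover_inf _ _ _ box box_vol)
  (cover_inf_sigma_subadditive box box_vol_ge0).

End lebesgue.

Section hausdorff.
Local Open Scope ereal_scope.
Context {R : realType} (d n : nat).

(* volume of the unit ball of R^n *)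
Fixpoint ball_vol (k : nat) : R :=
  match k with
  | 0 => 1
  | 1 => 2
  | (k'.+1 as k1).+1 => 2 * pi / k1.+1%:R * ball_vol k'
  end%R.

Definition ediam (A : set 'rV[R]_d) : \bar R :=
  ereal_sup [set (enorm (x - y))%:E | x in A & y in A].

(* only sets of diameter at most delta are admitted in coverings; with the
   usual normalization, H^n is the n-dimensional surface measure *)
Definition hausdorff_gauge (delta : R) (A : set 'rV[R]_d) : \bar R :=
  if `[< A = set0 >] then 0
  else if ediam A <= delta%:E then
    (ball_vol n / 2 ^+ n)%:E * ediam A ^+ n
  else +oo.

Definition hausdorff_outer (A : set 'rV[R]_d) : \bar R :=
  ereal_sup [set cover_inf id (hausdorff_gauge delta) A |
    delta in [set delta : R | (0 < delta)%R]].

Lemma ball_vol_ge0 k : (0 <= ball_vol k)%R.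
Proof.
elim/ltn_ind: k => -[|[|k]] IH //=.
by rewrite mulr_ge0 ?IH// divr_ge0// mulr_ge0// pi_ge0.
Qed.

Lemma hausdorff_gauge_ge0 delta A : 0 <= hausdorff_gauge delta A.
Proof.
rewrite /hausdorff_gauge; case: ifPn => // /asboolPn/eqP/set0P[x Ax].
case: ifPn => // _; rewrite mule_ge0 ?lee_fin ?divr_ge0 ?ball_vol_ge0//.
apply: expe_ge0; apply: ereal_sup_ubound.
by exists x => //; exists x => //; rewrite subrr /enorm /edot big1 ?sqrtr0// =>
  i _; rewrite big1// => j _; rewrite mxE mul0r.
Qed.

Lemma hausdorff_gauge0 delta : exists A, hausdorff_gauge delta A = 0.
Proof. by exists set0; rewrite /hausdorff_gauge; case: asboolP. Qed.

Lemma hausdorff_outer_ge0 A : 0 <= hausdorff_outer A.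
Proof.
apply: (@le_trans _ _ (cover_inf id (hausdorff_gauge 1) A)).
  by apply: cover_inf_ge0; exact: hausdorff_gauge_ge0.
by apply: ereal_sup_ubound; exists 1%R => //=.
Qed.

Lemma hausdorff_outer0 : hausdorff_outer set0 = 0.
Proof.
apply/eqP; rewrite eq_le hausdorff_outer_ge0 andbT.
apply: ge_ereal_sup => _ [delta _ <-]; rewrite cover_inf0//.
  exact: hausdorff_gauge_ge0.
exact: hausdorff_gauge0.
Qed.

Lemma le_hausdorff_outer : {homo hausdorff_outer : A B / A `<=` B >-> A <= B}.
Proof.
move=> A B AB; apply: ge_ereal_sup => _ [delta d0 <-].
apply: (@le_trans _ _ (cover_inf id (hausdorff_gauge delta) B)).
  exact: le_cover_inf.
by apply: ereal_sup_ubound; exists delta.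
Qed.

Lemma hausdorff_outer_sigma_subadditive : sigma_subadditive hausdorff_outer.
Proof.
move=> F; apply: ge_ereal_sup => _ [delta d0 <-].
apply: (le_trans (cover_inf_sigma_subadditive id
  (hausdorff_gauge_ge0 delta) F)).
apply: lee_nneseries => [k _ _|k _].
  by apply: cover_inf_ge0; exact: hausdorff_gauge_ge0.
by apply: ereal_sup_ubound; exists delta.
Qed.

HB.instance Definition _ := isOuterMeasure.Build R _ hausdorff_outer
  hausdorff_outer0 hausdorff_outer_ge0 le_hausdorff_outer
  hausdorff_outer_sigma_subadditive.

End hausdorff.

Definition lebesgue {R : realType} d : {outer_measure set 'rV[R]_d.+1 -> \bar R} :=
  @leb_outer R d.
Definition hausdorff {R : realType} d n : {outer_measure set 'rV[R]_d -> \bar R} :=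
  @hausdorff_outer R d n.

Notation leb_type R d := (caratheodory_type (@lebesgue R d)).
Notation surf_type R n := (caratheodory_type (@hausdorff R n.+1 n)).
Definition leb (R : realType) d : {measure set (leb_type R d) -> \bar R} :=
  (@lebesgue R d : set (leb_type R d) -> \bar R).
Definition surf (R : realType) n : {measure set (surf_type R n) -> \bar R} :=
  (@hausdorff R n.+1 n : set (surf_type R n) -> \bar R).

Section L2.
Context d {T : measurableType d} {R : realType}.
Variables (mu : {measure set T -> \bar R}) (D : set T).

Definition L2prod (f g : T -> R) : R := \int[mu]_(x in D) (f x * g x).

Definition L2norm (f : T -> R) : \bar R :=
  ((\int[mu]_(x in D) (f x ^+ 2)%:E) `^ 2^-1)%E.

Definition L2prodv k (f g : T -> 'rV[R]_k) : R :=
  \int[mu]_(x in D) edot (f x) (g x).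

Definition L2normv k (f : T -> 'rV[R]_k) : \bar R := L2norm (fun x => enorm (f x)).

Definition tensor_bounds k (M : T -> 'M[R]_k) (c C : R) : Prop :=
  (forall i j, measurable_fun D (fun x => M x i j)) /\
  {ae mu, forall x, D x -> M x \in unitmx /\ forall zeta : 'rV[R]_k,
    c * enorm zeta ^+ 2 <= inv_form (M x) zeta zeta /\
    enorm (invmx (M x) *m zeta^T) <= C * enorm zeta}.

End L2.

Section geometry.
Context {R : realType} {n : nat}.
Local Notation pt := 'rV[R]_n.+1.
Local Notation e_ i := (delta_mx 0 i : pt).

Definition bounded_domain (D : set pt) : Prop :=
  [/\ open D, connected D, D !=set0 & bounded_set D].

Definition lipschitz_boundary (D : set pt) : Prop :=
  forall x, boundary D x ->
  exists (r L : R) (Q : 'M[R]_n.+1) (g : 'rV[R]_n -> R),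
    [/\ 0 < r, Q *m Q^T = 1%:M,
        forall s t, `|g s - g t| <= L * enorm (s - t) &
        forall y, enorm (y - x) < r ->
          (D y <-> (y *m Q) 0 ord_max < g (col' ord_max (y *m Q)))].

Definition C2_on (U : set pt) (phi : pt -> R) : Prop :=
  forall i j : 'I_n.+1,
    [/\ forall y, U y -> derivable phi y (e_ i),
        {within U, continuous ('D_(e_ i) phi)},
        forall y, U y -> derivable ('D_(e_ i) phi) y (e_ j) &
        {within U, continuous ('D_(e_ j) ('D_(e_ i) phi))}].

Definition C2_surface (S : set pt) : Prop :=
  forall x, S x -> exists (U : set pt) (phi : pt -> R),
    [/\ open U, U x, C2_on U phi,
        forall y, U y -> exists i, 'D_(e_ i) phi y != 0 &
        forall y, U y -> (S y <-> phi y = 0)].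

Definition outward_unit_normal (D : set pt) (x nu : pt) : Prop :=
  enorm nu = 1 /\ forall v : pt,
    (edot v nu < 0 -> \forall t \near 0^'+, D (x + t *: v)) /\
    (0 < edot v nu -> \forall t \near 0^'+, ~ D (x + t *: v)).

Record geometry := Geometry {
  Omega : set pt;
  Om : 'I_2 -> set pt;
  gam : set pt;
  nrm : 'I_2 -> pt -> pt;
  frame : pt -> 'M[R]_(n, n.+1) }.

Variable G : geometry.

(* Since gam is contained in the open set Omega, the identity
   gam = bd Omega_1 /\ bd Omega_2 is meant inside Omega: the closed set
   bd Omega_1 /\ bd Omega_2 also contains the end points of gam on bd Omega.
   The rows of frame x are an orthonormal basis of the tangent space of gam at
   x, through which that space is identified with R^n. *)
Definition fractured_domain : Prop :=
  [/\ bounded_domain (Omega G) /\ lipschitz_boundary (Omega G),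
      (forall i, [/\ open (Om G i), connected (Om G i) & Om G i !=set0]) /\
        Om G ord0 `&` Om G ord_max = set0,
      [/\ Omega G = Om G ord0 `|` Om G ord_max `|` gam G,
          gam G = boundary (Om G ord0) `&` boundary (Om G ord_max) `&` Omega G &
          C2_surface (gam G)],
      forall i, [/\ forall x, gam G x -> outward_unit_normal (Om G i) x (nrm G i x),
          {ae surf R n, forall x, boundary (Om G i) x ->
             outward_unit_normal (Om G i) x (nrm G i x)} &
          forall j, measurable_fun (boundary (Om G i) : set (surf_type R n))
             (fun x => nrm G i x 0 j)] &
      (forall x, gam G x -> frame G x *m (frame G x)^T = 1%:M /\
          frame G x *m (nrm G ord0 x)^T = 0) /\
        forall i j, measurable_fun (gam G : set (surf_type R n))
          (fun x => frame G x i j)].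

End geometry.

Section mesh.
Context {R : realType}.

(* A k-dimensional element of R^d: the simplex with vertices a and
   a + row j E, or the rectangle spanned at a by the rows of E, where
   a = corner and E = edges. *)
Record cell (k d : nat) := Cell {
  corner : 'rV[R]_d; edges : 'M[R]_(k, d); simplicial : bool }.

Record mesh (k d : nat) := Mesh { ncell : nat; mcell : 'I_ncell -> cell k d }.
Arguments mcell {k d} m j.

Section cells.
Context {k d : nat}.
Implicit Types (T : cell k d) (m : mesh k d) (t : 'rV[R]_k) (x : 'rV[R]_d).

Definition nondegenerate T : Prop :=
  row_free (edges T) /\
  (~~ simplicial T -> is_diag_mx (edges T *m (edges T)^T)).

Definition elt_map T t : 'rV[R]_d := corner T + t *m edges T.

(* coordinates of the orthogonal projection of x on the affine hull of T *)
Definition coord_of T x : 'rV[R]_k :=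
  (x - corner T) *m (edges T)^T *m invmx (edges T *m (edges T)^T).

(* The element is the image under elt_map T of the t at which all these functions
   are nonnegative; each facet is the part where one of them vanishes. All
   indices (false, j) of a simplex denote the same facet. *)
Definition slack T (f : bool * 'I_k) t : R :=
  if f.1 then t 0 f.2
  else if simplicial T then 1 - \sum_i t 0 i else 1 - t 0 f.2.

Definition closed_cell T : set 'rV[R]_d :=
  elt_map T @` [set t | forall f, 0 <= slack T f t].
Definition open_cell T : set 'rV[R]_d :=
  elt_map T @` [set t | forall f, 0 < slack T f t].
Definition face T (F : {set bool * 'I_k}) : set 'rV[R]_d :=
  elt_map T @` [set t | (forall f, 0 <= slack T f t) /\
                      (forall f, f \in F -> slack T f t = 0)].
Definition facet T f : set 'rV[R]_d := face T [set f]%SET.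

Definition is_partition (D : set 'rV[R]_d) m : Prop :=
  [/\ forall j, nondegenerate (mcell m j),
      forall j, open_cell (mcell m j) `<=` D,
      forall j j', j != j' ->
        open_cell (mcell m j) `&` open_cell (mcell m j') = set0 &
      closure D = \bigcup_j closed_cell (mcell m j)].

Definition meet_in_face T T' : Prop :=
  exists F F', closed_cell T `&` closed_cell T' = face T F /\
               face T F = face T' F'.

Definition mesh_size m : R := \big[Num.max/0]_j cdiam (closed_cell (mcell m j)).

(* A discrete function is given by one polynomial per element. *)
Definition sfield m := 'I_(ncell m) -> R.
Definition vfield m := 'I_(ncell m) -> 'rV[R]_d -> 'rV[R]_d.

(* Its value at x is taken in an element containing x, hence is the trace when
   x lies on the boundary of the union of the elements; it is ambiguous only
   on facets common to several elements. *)
Definition glue (V : nmodType) m (f : 'I_(ncell m) -> 'rV[R]_d -> V)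
    (x : 'rV[R]_d) : V :=
  if [pick j | `[< closed_cell (mcell m j) x >]] is Some j then f j x else 0.

Definition sval m (p : sfield m) : 'rV[R]_d -> R := glue (fun j _ => p j).

(* In the coordinates t of the element: RT_0 = P_0^k + t P_0 on a simplex, and
   i-th component affine in t_i alone on a rectangle. *)
Definition local_RT0 T (u : 'rV[R]_d -> 'rV[R]_d) : Prop :=
  exists w b : 'rV[R]_k, (simplicial T -> forall i j, b 0 i = b 0 j) /\
    forall x, u x = (w + coord_of T x *m diag_mx b) *m edges T.

(* Normal components are continuous across the facets interior to D. On a
   surface, nu is a vector normal to the facet, not necessarily tangent to the
   surface; this is harmless as the two elements are coplanar there. *)
Definition RT0 (D : set 'rV[R]_d) m (u : vfield m) : Prop :=
  (forall j, local_RT0 (mcell m j) (u j)) /\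
  forall j j' f f', facet (mcell m j) f = facet (mcell m j') f' ->
    forall x nu, facet (mcell m j) f x -> D x ->
      (forall y, facet (mcell m j) f y -> edot (y - x) nu = 0) ->
      edot (u j x) nu = edot (u j' x) nu.

End cells.

Definition div d (m : mesh d d) (u : vfield m) : 'rV[R]_d -> R :=
  glue (fun j x => \tr (jacobian (u j) x)).

Definition tangential_div k d (fr : 'rV[R]_d -> 'M[R]_(k, d)) (m : mesh k d)
    (u : vfield m) : 'rV[R]_d -> R :=
  glue (fun j x => \tr (fr x *m jacobian (u j) x *m (fr x)^T)).

End mesh.
Arguments cell : clear implicits.
Arguments mesh : clear implicits.
Arguments mcell {R k d} m j.

Section discretization.
Context {R : realType} {n : nat}.
Variables (G : @geometry R n).
Variables (Th : 'I_2 -> mesh R n.+1 n.+1) (Tg : mesh R n n.+1).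
Local Notation pt := 'rV[R]_n.+1.

Definition hmax : R :=
  Num.max (Num.max (mesh_size (Th ord0)) (mesh_size (Th ord_max))) (mesh_size Tg).

Definition quasi_uniform (rho : R) : Prop :=
  forall i j, exists c : pt, [set x | enorm (x - c) <=
      rho * Num.max (mesh_size (Th ord0)) (mesh_size (Th ord_max))]
    `<=` closed_cell (mcell (Th i) j).

(* Elements of Tg are unions of facets of the bulk mesh. *)
Definition induced_or_coarser : Prop :=
  forall i j f, facet (mcell (Th i) j) f `<=` closure (gam G) ->
    exists s, facet (mcell (Th i) j) f `<=` closed_cell (mcell Tg s).

Definition normal_trace i (u : vfield (Th i)) (x : pt) : R :=
  edot (glue u x) (nrm G i x).

Definition discrete_trace_ineq (CdTr : R) : Prop :=
  forall i (u : vfield (Th i)), RT0 (Om G i) u ->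
    (L2norm (surf R n) (boundary (Om G i)) (normal_trace u) <=
     (CdTr * hmax `^ (- 2^-1))%:E * L2normv (leb R n) (Om G i) (glue u))%E.

Definition inverse_ineq (Cinv : R) : Prop :=
  forall u : vfield Tg, RT0 (gam G) u ->
    (L2norm (surf R n) (gam G) (tangential_div (frame G) u) <=
     (Cinv * hmax^-1)%:E * L2normv (surf R n) (gam G) (glue u))%E.

(* w . n_i is the L2(gam)-projection of lambda on V_{h,i} . n_i *)
Definition is_normal_projection i (lambda : sfield Tg) (w : vfield (Th i)) : Prop :=
  RT0 (Om G i) w /\ forall v : vfield (Th i), RT0 (Om G i) v ->
    L2prod (surf R n) (gam G) (normal_trace w) (normal_trace v) =
    L2prod (surf R n) (gam G) (sval lambda) (normal_trace v).

Definition mortar_condition (CQ : R) : Prop :=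
  forall (lambda : sfield Tg) (w : forall i, vfield (Th i)),
    (forall i, is_normal_projection lambda (w i)) ->
    (L2norm (surf R n) (gam G) (sval lambda) <=
     CQ%:E * (L2norm (surf R n) (gam G) (normal_trace (w ord0)) +
              L2norm (surf R n) (gam G) (normal_trace (w ord_max))))%E.

Definition admissible_meshes (rho CQ CdTr Cinv : R) : Prop :=
  [/\ (forall i, is_partition (Om G i) (Th i)) /\
        (forall i j i' j', meet_in_face (mcell (Th i) j) (mcell (Th i') j')),
      quasi_uniform rho,
      [/\ is_partition (gam G) Tg,
          forall j j', meet_in_face (mcell Tg j) (mcell Tg j') &
          induced_or_coarser],
      mortar_condition CQ &
      discrete_trace_ineq CdTr /\ inverse_ineq Cinv].

Section forms.
Variables (K : pt -> 'M[R]_n.+1) (Kg : pt -> 'M[R]_n).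

(* ralpha stands for 1 / alpha_gamma, and is 0 when alpha_gamma -> oo *)
Definition a_bulk (ralpha : R) i (u v : vfield (Th i)) : R :=
  (\int[leb R n]_(x in Om G i) inv_form (K x) (glue u x) (glue v x)) +
  ralpha * L2prod (surf R n) (gam G) (normal_trace u) (normal_trace v).
Definition b_bulk i (u : vfield (Th i)) (q : sfield (Th i)) : R :=
  L2prod (leb R n) (Om G i) (div u) (sval q).
Definition c_bulk i (p q : sfield (Th i)) : R :=
  L2prod (leb R n) (Om G i) (sval p) (sval q).

Definition local_solution (ralpha tau : R) i (lambda : sfield Tg)
    (u : vfield (Th i)) (p : sfield (Th i)) : Prop :=
  [/\ RT0 (Om G i) u,
      forall v : vfield (Th i), RT0 (Om G i) v ->
        a_bulk ralpha u v - b_bulk v p =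
        - L2prod (surf R n) (gam G) (sval lambda) (normal_trace v) &
      forall q : sfield (Th i), c_bulk p q + tau * b_bulk u q = 0].

Definition s_gamma (us : forall i, sfield Tg -> vfield (Th i))
    (lambda mu : sfield Tg) : R :=
  - \sum_i L2prod (surf R n) (gam G) (normal_trace (us i lambda)) (sval mu).

Definition a_gamma (u v : vfield Tg) : R :=
  \int[surf R n]_(x in gam G)
    inv_form (Kg x) (glue u x *m (frame G x)^T) (glue v x *m (frame G x)^T).
Definition b_gamma (u : vfield Tg) (mu : sfield Tg) : R :=
  L2prod (surf R n) (gam G) (tangential_div (frame G) u) (sval mu).

Definition A_gamma (Lg tau : R) (x y : vfield Tg * sfield Tg) : R :=
  a_gamma x.1 y.1 + Lg * L2prodv (surf R n) (gam G) (glue x.1) (glue y.1)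
  + tau^-1 * L2prod (surf R n) (gam G) (sval x.2) (sval y.2)
  + b_gamma x.1 y.2 - b_gamma y.1 x.2.

(* |K_gamma^(-1/2) v|^2 is the quadratic form v^T K_gamma^-1 v *)
Definition star_norm (Lg tau : R) (y : vfield Tg * sfield Tg) : \bar R :=
  ((\int[surf R n]_(x in gam G)
      (inv_form (Kg x) (glue y.1 x *m (frame G x)^T)
                       (glue y.1 x *m (frame G x)^T))%:E
   + L2normv (surf R n) (gam G) (fun x => Num.sqrt Lg *: glue y.1 x)%R ^+ 2
   + L2norm (surf R n) (gam G) (fun x => tau `^ (- 2^-1) * sval y.2 x)%R ^+ 2)
   `^ 2^-1)%E.

End forms.

Section matrix.
Variable (N : nat).

Definition combination (e : 'I_N -> vfield Tg * sfield Tg) (V : 'cV[R]_N) :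
    vfield Tg * sfield Tg :=
  (fun j x => \sum_i V i 0 *: (e i).1 j x, fun j => \sum_i V i 0 * (e i).2 j).

Definition is_basis (e : 'I_N -> vfield Tg * sfield Tg) : Prop :=
  (forall i, RT0 (gam G) (e i).1) /\
  forall (u : vfield Tg) (lambda : sfield Tg), RT0 (gam G) u ->
    exists! V : 'cV[R]_N, combination e V = (u, lambda).

Definition norm_equivalence (e : 'I_N -> vfield Tg * sfield Tg)
    (Kg : pt -> 'M[R]_n) (Lg tau cmu Cmu : R) : Prop :=
  forall V : 'cV[R]_N,
    ((cmu * hmax `^ (n.+1%:R / 2) * enorm V)%:E
      <= star_norm Kg Lg tau (combination e V)
      <= (Cmu * hmax `^ (n.+1%:R / 2) * enorm V)%:E)%E.

Definition is_DD_matrix (e : 'I_N -> vfield Tg * sfield Tg)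
    (K : pt -> 'M[R]_n.+1) (Kg : pt -> 'M[R]_n) (Lg ralpha tau : R)
    (A : 'M[R]_N) : Prop :=
  exists (us : forall i, sfield Tg -> vfield (Th i))
         (ps : forall i, sfield Tg -> sfield (Th i)),
    (forall i lambda,
       local_solution K ralpha tau lambda (us i lambda) (ps i lambda)) /\
    forall V W : 'cV[R]_N,
      edot (A *m V) W =
      A_gamma Kg Lg tau (combination e V) (combination e W) +
      s_gamma us (combination e V).2 (combination e W).2.

End matrix.
End discretization.

Section condition_number.
Context {R : realType} {N : nat}.

Definition opnorm (A : 'M[R]_N) : R :=
  sup [set sup [set edot (A *m V) W / (enorm V * enorm W) |
                W in [set W : 'cV[R]_N | W != 0]] |
       V in [set V : 'cV[R]_N | V != 0]].

Definition cond (A : 'M[R]_N) : R := opnorm A * opnorm (invmx A).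

End condition_number.

(* Main.v *)
Require Import Defs.
From mathcomp Require Import all_boot all_order all_algebra.
From mathcomp Require Import all_classical all_reals all_analysis.
From mathcomp Require Import measurable_realfun.
From mathcomp Require Import ring lra.
Set Implicit Arguments.
Unset Strict Implicit.
Unset Printing Implicit Defensive.
Import Order.TTheory GRing.Theory Num.Theory.
Import numFieldNormedType.Exports.
Local Open Scope classical_set_scope.
Local Open Scope ring_scope.

(** The fracture form and the interface form are estimated in the norm star of
the unknowns (u, lambda), where star^2 is the sum of the energies of u for
K_gamma^-1 and L_gamma and of |lambda|^2 / tau. On the diagonal the two
divergence terms of the fracture form cancel, so that it equals star^2
(A_gamma_diag). Testing the local problems with their own solutions gives that s_gamma is nonnegative
(s_gamma_ge0). Hence the matrix is coercive with constant one
(DD_matrix_coercive), which gives its invertibility and the bound of its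
inverse.

For the bound of the matrix itself, the same energy identity bounds the normal
trace of a local solution by beta |lambda| (local_trace_bound), where beta is
alpha_gamma if the Robin term is present, and C_dTr^2 / (c_K h), by the discrete
trace inequality, if the pressure is continuous. So s_gamma contributes
2 beta tau to the continuity constant. The inverse inequality bounds the
divergence terms by C_inv tau^(1/2) / h, up to a constant, and
s <= 1 + s^2 with s = tau^(1/2) / h brings this under
1 + C_inv c_(K,gamma) tau / h^2. The equivalence of star with the Euclidean norm
of the coordinates introduces the same power of h above and below, which cancels
in the condition number (coercive_cond, DD_matrix_cond).

These are a few lines of algebra once all integrals are known to be integrals
of measurable and square integrable functions, and most of the work is there.
Measurability is that of Caratheodory for the Lebesgue and Hausdorff outer
measures. It suffices to have it for half-spaces: for the Hausdorff measure this
follows from its additivity on sets at a positive distance, by Caratheodory's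
criterion, and for the Lebesgue measure from cutting boxes by a hyperplane. Then
open sets, hence the subdomains and the fracture, are measurable, and so are the
coordinate functions, hence the mesh elements and the piecewise affine fields.
Square integrability on the fracture is read off the
assumed equivalence of norms: every discrete function has a finite norm, and the
function (0, 1) shows that the fracture has finite area, so that bounded normal
traces are square integrable as well. *)

(** * Caratheodory's criterion and Euclidean norms *)

Section separated.
Local Open Scope ereal_scope.
Context {R : realType} {T : Type}.
Variables (mu : {outer_measure set T -> \bar R}) (f : T -> R).
Hypothesis sep : forall (a b : R) (X Y : set T), (a < b)%R ->
  (forall x, X x -> (f x <= a)%R) -> (forall x, Y x -> (b <= f x)%R) ->
  mu X + mu Y <= mu (X `|` Y).

(** Caratheodory's criterion for one function: if mu is additive on pairs of
sets that f separates by a gap, then the sublevel sets of f are measurable.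
The part of Z above the level c is exhausted by the parts above c + 1 / (m + 1),
for which additivity is known, and the layers in between have a convergent sum
of measures, so that what is left out tends to zero. *)
Lemma separated_sublevel_caratheodory c :
  mu.-caratheodory [set x | (f x <= c)%R].
Proof.
apply: le_caratheodory_measurable => Z.
have [->|Zoo] := eqVneq (mu Z) +oo; first by rewrite leey.
have Zfin : mu Z \is a fin_num.
  by rewrite ge0_fin_numE ?ltey// outer_measure_ge0.
set g := fun s : R => mu (Z `&` [set x | (f x <= s)%R]).
pose a (j : nat) : R := (c + j.+1%:R^-1)%R.
pose ring (j : nat) := Z `&` [set x | (a j.+1 < f x <= a j)%R].
have aS j : (a j.+1 < a j)%R by rewrite ltrD2l ltf_pV2 ?posrE ?ltr0n ?ltr_nat.
have ca j : (c < a j)%R by rewrite ltrDl invr_gt0 ltr0n.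
have leZ X : X `<=` Z -> mu X <= mu Z by exact: le_outer_measure.
have fin X : X `<=` Z -> mu X \is a fin_num.
  move=> XZ; rewrite ge0_fin_numE ?outer_measure_ge0//.
  by rewrite (le_lt_trans (leZ _ XZ))// ltey.
(* a layer is separated from the sublevel two steps below, so the sums of
   layers telescope in steps of two *)
have step j : g (a j.+2) + mu (ring j) <= g (a j).
  apply: le_trans (sep (aS j.+1) _ _) _ => [x []//|x [_ /= /andP[/ltW//]]|].
  apply: le_outer_measure => x [[Zx /= fx]|[Zx /= /andP[_ fx]]]; split => //=.
  by rewrite (le_trans fx)// ltW// (lt_trans (aS _)).
have telescope m :
    \sum_(0 <= j < m) mu (ring j) + (g (a m) + g (a m.+1)) <= mu Z + mu Z.
  elim: m => [|m IH].
    by rewrite big_geq// add0e leeD// leZ// => x [].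
  apply: le_trans IH; rewrite big_nat_recr//= -addeA leeD2l//.
  rewrite [g (a m.+1) + _]addeC addeA [mu _ + _]addeC.
  by rewrite leeD2r.
have sum_fin : \sum_(j <oo) mu (ring j) < +oo.
  apply: (@le_lt_trans _ _ (mu Z + mu Z)); last first.
    by rewrite ltey_eq fin_numD Zfin.
  apply: lime_le; first by apply: is_cvg_nneseries => *; exact: outer_measure_ge0.
  near=> m; apply: le_trans (telescope m).
  by rewrite leeDl// adde_ge0// outer_measure_ge0.
have tail0 : \sum_(m <= j <oo) mu (ring j) @[m --> \oo] --> 0.
  by apply: nneseries_tail_cvg => // j _; exact: outer_measure_ge0.
have key m : g c + mu (Z `&` ~` [set x | (f x <= c)%R]) <=
    mu Z + \sum_(m <= j <oo) mu (ring j).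
  have -> : Z `&` ~` [set x | (f x <= c)%R] =
      (Z `&` [set x | (a m < f x)%R]) `|` \bigcup_(j in ~` `I_m) ring j.
    apply/seteqP; split => x /=.
      move=> [Zx /negP]; rewrite -ltNge => cx.
      have [amx|xam] := ltP (a m) (f x); [by left|right].
      have [j jx] : exists j, (a j < f x)%R.
        have d0 : (0 < f x - c)%R by rewrite subr_gt0.
        have [j _ /(_ _ (leqnn j))] := near_infty_natSinv_lt (PosNum d0).
        by rewrite /= ltrBrDl => ?; exists j.
      pose P := fun j => (a j < f x)%R.
      have exP : exists j, P j by exists j.
      case: (ex_minnP exP) => k Pk kmin.
      have mk : (m < k)%N.
        rewrite ltnNge; apply/negP => km.
        have : (a m <= a k)%R.
          by rewrite lerD2l lef_pV2 ?posrE ?ltr0n// ler_nat.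
        by move/(le_trans xam)/le_lt_trans => /(_ _ Pk); rewrite ltxx.
      case: k Pk kmin mk => // k Pk kmin mk.
      exists k; first by apply/negP; rewrite -leqNgt.
      split => //=; rewrite [X in X && _]Pk /= leNgt; apply/negP => /kmin.
      by rewrite ltnn.
    move=> [[Zx amx]|[j _ [Zx /= /andP[ajx _]]]]; split => //; apply/negP;
      rewrite -ltNge; [exact: lt_trans amx|exact: lt_trans ajx].
  apply: le_trans (leeD2l _ (outer_measureU2 _ _ _)) _.
  rewrite addeA leeD//; last exact: outer_measure_sigma_subadditive_tail.
  apply: le_trans (sep (ca m) _ _) _ => [x []//|x [_ /= /ltW//]|].
  by apply: leZ => x [[]|[]].
have -> : mu Z = lim ((mu Z + \sum_(m <= j <oo) mu (ring j)) @[m --> \oo]).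
  apply/esym/cvg_lim => //; rewrite -[X in _ --> X]adde0.
  by apply: cvgeD => //; [rewrite fin_num_adde_defr|exact: cvg_cst].
apply: lime_ge; last by near=> m; exact: key.
apply/cvg_ex; exists (mu Z + 0).
by apply: cvgeD => //; [rewrite fin_num_adde_defr|exact: cvg_cst].
Unshelve. all: by end_near. Qed.

End separated.

Section euclidean_norm.
Context {R : realType}.

Lemma edotE m n (A B : 'M[R]_(m, n)) : edot A B = \tr (A *m B^T).
Proof. by apply: eq_bigr => i _; rewrite !mxE; apply: eq_bigr => j _; rewrite mxE. Qed.

Lemma edotC m n (A B : 'M[R]_(m, n)) : edot A B = edot B A.
Proof. by apply: eq_bigr => i _; apply: eq_bigr => j _; rewrite mulrC. Qed.

Lemma edotDl m n (A B C : 'M[R]_(m, n)) : edot (A + B) C = edot A C + edot B C.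
Proof.
rewrite /edot -big_split; apply: eq_bigr => i _; rewrite -big_split.
by apply: eq_bigr => j _; rewrite mxE mulrDl.
Qed.

Lemma edotZl m n a (A B : 'M[R]_(m, n)) : edot (a *: A) B = a * edot A B.
Proof.
rewrite /edot mulr_sumr; apply: eq_bigr => i _; rewrite mulr_sumr.
by apply: eq_bigr => j _; rewrite mxE mulrA.
Qed.

Lemma edotZr m n a (A B : 'M[R]_(m, n)) : edot A (a *: B) = a * edot A B.
Proof. by rewrite edotC edotZl edotC. Qed.

Lemma edotDr m n (A B C : 'M[R]_(m, n)) : edot A (B + C) = edot A B + edot A C.
Proof. by rewrite edotC edotDl !(edotC A). Qed.

Lemma edot_ge0 m n (A : 'M[R]_(m, n)) : 0 <= edot A A.
Proof.
by apply: sumr_ge0 => i _; apply: sumr_ge0 => j _; rewrite -expr2 sqr_ge0.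
Qed.

Lemma enorm_ge0 m n (A : 'M[R]_(m, n)) : 0 <= enorm A.
Proof. exact: sqrtr_ge0. Qed.

Lemma sqr_enorm m n (A : 'M[R]_(m, n)) : enorm A ^+ 2 = edot A A.
Proof. by rewrite sqr_sqrtr// edot_ge0. Qed.

Lemma edot_eq0 m n (A : 'M[R]_(m, n)) : (edot A A == 0) = (A == 0).
Proof.
apply/eqP/eqP => [A0|->]; last first.
  by rewrite /edot big1// => i _; rewrite big1// => j _; rewrite mxE mul0r.
apply/matrixP => i j; rewrite mxE; apply/eqP.
have row_ge0 i' : 0 <= \sum_j A i' j * A i' j.
  by apply: sumr_ge0 => k _; rewrite -expr2 sqr_ge0.
have /(_ i isT) /psumr_eq0P := psumr_eq0P (fun i _ => row_ge0 i) A0.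
move=> /(_ _ j isT); rewrite -expr2 => Aij; rewrite -sqrf_eq0; apply/eqP/Aij.
by move=> k _; rewrite -expr2 sqr_ge0.
Qed.

Lemma enorm_eq0 m n (A : 'M[R]_(m, n)) : (enorm A == 0) = (A == 0).
Proof. by rewrite -sqrf_eq0 sqr_enorm edot_eq0. Qed.

Lemma enormZ m n a (A : 'M[R]_(m, n)) : enorm (a *: A) = `|a| * enorm A.
Proof. by rewrite /enorm edotZl edotZr mulrA -expr2 sqrtrM ?sqr_ge0// sqrtr_sqr. Qed.

(** Optimizing the weight t in a weighted arithmetic-geometric inequality gives
the product form; both Cauchy-Schwarz inequalities below, for matrices and for
integrals, are obtained in this way. The optimal weight is c / F, and when
F = 0 a large weight shows that c cannot be positive. *)
Lemma weighted_bound_CS (c F G : R) : 0 <= F -> 0 <= G ->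
  (forall t : R, 0 < t -> 2 * c <= t * F + t^-1 * G) ->
  c <= Num.sqrt F * Num.sqrt G.
Proof.
move=> F0 G0 tc; have [c0|c0] := leP c 0.
  by rewrite (le_trans c0)// mulr_ge0 ?sqrtr_ge0.
rewrite -sqrtrM// -(ger0_norm (ltW c0)) -sqrtr_sqr ler_wsqrtr//.
move: F0; rewrite le_eqVlt => /predU1P[F0|F0].
  have := tc ((G + 1) / c); rewrite -F0 mulr0 add0r; rewrite divr_gt0 ?ltr_wpDl// => /(_ isT).
  rewrite invf_div mulrAC => H; exfalso; move: H; apply/negP; rewrite -ltNge.
  rewrite ltr_pdivrMr ?ltr_wpDl//; nra.
have := tc (c / F); rewrite divr_gt0// => /(_ isT).
rewrite invf_div divfK ?gt_eqF// => H.
have {}H : c <= F / c * G by lra.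
by rewrite mulrAC ler_pdivlMr// -expr2 in H.
Qed.

Lemma edot_le m n (A B : 'M[R]_(m, n)) : `|edot A B| <= enorm A * enorm B.
Proof.
have CS (A' B' : 'M[R]_(m, n)) : edot A' B' <= enorm A' * enorm B'.
  apply: weighted_bound_CS; rewrite ?edot_ge0// => t t0.
  have := edot_ge0 (t *: A' - B'); rewrite -scaleN1r.
  rewrite !(edotDl, edotDr, edotZl, edotZr) (edotC B' A') => H.
  rewrite -(ler_pM2l t0) mulrDr !mulrA divff ?gt_eqF// mul1r; nra.
rewrite ler_norml CS andbT lerNl -mulN1r -edotZl.
by rewrite (le_trans (CS _ _))// enormZ normrN1 mul1r.
Qed.

End euclidean_norm.

(** * Measurability of half-spaces and open sets *)

Lemma ler_abs_enorm (R : realType) m n (A : 'M[R]_(m, n)) i j :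
  `|A i j| <= enorm A.
Proof.
rewrite -sqrtr_sqr ler_wsqrtr// /edot (bigD1 i)//= (bigD1 j)//= -expr2 -addrA.
rewrite lerDl addr_ge0// sumr_ge0// => k _; rewrite -?expr2 ?sqr_ge0//.
by apply: sumr_ge0 => l _; rewrite -expr2 sqr_ge0.
Qed.

Section hausdorff_halfspace.
Local Open Scope ereal_scope.
Context {R : realType} (d n : nat).

Lemma le_hausdorff_cover (delta delta' : R) (A : set 'rV[R]_d) :
  (delta <= delta')%R ->
  cover_inf id (hausdorff_gauge n delta') A <=
  cover_inf id (hausdorff_gauge n delta) A.
Proof.
move=> dd; apply: le_ereal_inf_tmp => _ [c Ac <-].
apply: (@le_trans _ _ (\sum_(k <oo) hausdorff_gauge n delta' (c k))).
  by apply: ereal_inf_lbound; exists c.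
apply: lee_nneseries => [k _ _|k _]; first exact: hausdorff_gauge_ge0.
rewrite /hausdorff_gauge; case: ifPn => // _.
case: (ifPn (ediam (c k) <= delta%:E)) => [h|_]; last by rewrite leey.
by rewrite (le_trans h)// lee_fin.
Qed.

(** A set of diameter less than b - a cannot meet both X and Y, so a fine cover
of the union splits into a cover of X and a cover of Y. A cover with a member of
infinite gauge gives nothing to prove. *)
Lemma hausdorff_cover_separated (i : 'I_d) (delta a b : R) (X Y : set 'rV[R]_d) :
  (delta < b - a)%R ->
  (forall x, X x -> (x ord0 i <= a)%R) -> (forall x, Y x -> (b <= x ord0 i)%R) ->
  cover_inf id (hausdorff_gauge n delta) X +
  cover_inf id (hausdorff_gauge n delta) Y <=
  cover_inf id (hausdorff_gauge n delta) (X `|` Y).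
Proof.
move=> dab Xa Yb; apply: le_ereal_inf_tmp => _ [c XYc <-].
set g := hausdorff_gauge n delta.
have g0 A : 0 <= g A by exact: hausdorff_gauge_ge0.
have gset0 : g set0 = 0 by rewrite /g /hausdorff_gauge; case: asboolP.
have [[k gk]|goo] := pselect (exists k, g (c k) = +oo).
  rewrite (@eseries_pinfty _ _ _ k) ?leey// => j _.
  by rewrite -ltNye (lt_le_trans _ (g0 _)).
pose c1 k := if `[< c k `&` X !=set0 >] then c k else set0.
pose c2 k := if `[< c k `&` X !=set0 >] then set0 else c k.
apply: (@le_trans _ _ (\sum_(k <oo) g (c1 k) + \sum_(k <oo) g (c2 k))).
  apply: leeD; apply: ereal_inf_lbound.
    exists c1 => //= x Xx; have [k _ ckx] := XYc x (or_introl Xx).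
    by exists k => //; rewrite /c1; case: asboolP => // -[]; exists x.
  exists c2 => //= y Yy; have [k _ cky] := XYc y (or_intror Yy).
  exists k => //; rewrite /c2; case: asboolP => // -[x [ckx Xx]]; exfalso.
  apply: goo; exists k; rewrite /g /hausdorff_gauge.
  case: asboolP => [ck0|_]; first by move: ckx; rewrite ck0.
  case: ifPn => // h; exfalso; move: h; apply/negP; rewrite -ltNge.
  apply: (@lt_le_trans _ _ (enorm (y - x))%:E); last first.
    by apply: ereal_sup_ubound; exists y => //; exists x.
  rewrite lte_fin (lt_le_trans dab)//.
  apply: (@le_trans _ _ (y ord0 i - x ord0 i)%R).
    by rewrite lerB// ?Yb ?Xa.
  have := ler_abs_enorm (y - x) ord0 i; rewrite !mxE.
  by apply: le_trans; exact: ler_norm.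
rewrite -nneseriesD//; apply: lee_nneseries => [k _ _|k _].
  by rewrite adde_ge0.
by rewrite /c1 /c2; case: asboolP => _; rewrite gset0 ?adde0 ?add0e.
Qed.

(** At a scale below the gap the covers split; refining the scale only increases
the infimum over covers, so the estimate passes to the supremum over scales. *)
Lemma hausdorff_separated (i : 'I_d) (a b : R) (X Y : set 'rV[R]_d) :
  (a < b)%R ->
  (forall x, X x -> (x ord0 i <= a)%R) -> (forall x, Y x -> (b <= x ord0 i)%R) ->
  hausdorff d n X + hausdorff d n Y <= hausdorff d n (X `|` Y).
Proof.
move=> ab Xa Yb; set Z := X `|` Y.
have [->|Zoo] := eqVneq (hausdorff d n Z) +oo; first by rewrite leey.
have Zfin A : A `<=` Z -> hausdorff d n A \is a fin_num.
  move=> AZ; rewrite ge0_fin_numE ?outer_measure_ge0//.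
  by rewrite (le_lt_trans (le_outer_measure _ _ _ AZ))// ltey.
have key (delta0 delta1 : R) : (0 < delta0)%R -> (0 < delta1)%R ->
    cover_inf id (hausdorff_gauge n delta0) X +
    cover_inf id (hausdorff_gauge n delta1) Y <= hausdorff d n Z.
  move=> d00 d10.
  pose delta := Num.min (Num.min delta0 delta1) ((b - a) / 2)%R.
  have ba0 : (0 < b - a)%R by rewrite subr_gt0.
  have dba : (delta < b - a)%R.
    by rewrite (@le_lt_trans _ _ ((b - a) / 2)%R)// ?ge_min ?lexx ?orbT//; lra.
  have d0 : (0 < delta)%R by rewrite !lt_min d00 d10 divr_gt0.
  apply: (@le_trans _ _ (cover_inf id (hausdorff_gauge n delta) X +
    cover_inf id (hausdorff_gauge n delta) Y)).
    by apply: leeD; apply: le_hausdorff_cover; rewrite !ge_min lexx ?orbT.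
  apply: le_trans (hausdorff_cover_separated dba Xa Yb) _.
  by apply: ereal_sup_ubound; exists delta.
have finX : hausdorff d n X \is a fin_num by apply: Zfin => x; left.
have finY : hausdorff d n Y \is a fin_num by apply: Zfin => x; right.
have fin_cover A (delta : R) : (0 < delta)%R -> hausdorff d n A \is a fin_num ->
    cover_inf id (hausdorff_gauge n delta) A \is a fin_num.
  move=> d0; rewrite !ge0_fin_numE ?outer_measure_ge0//; last first.
    by apply: cover_inf_ge0; exact: hausdorff_gauge_ge0.
  by apply: le_lt_trans; apply: ereal_sup_ubound; exists delta.
rewrite -leeBrDr//; apply: ge_ereal_sup => _ [delta0 d00 <-].
have finX0 := fin_cover _ _ d00 finX.
rewrite leeBrDr// addeC -leeBrDr//; apply: ge_ereal_sup => _ [delta1 d10 <-].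
by rewrite leeBrDr// addeC key.
Qed.

End hausdorff_halfspace.

(** Open sets are reached from half-spaces by complements and countable unions,
so this property is all that the measurability arguments need from the volume
and from the surface measure. *)
Definition halfspaces_measurable (R : realType) d
    (mu : {outer_measure set 'rV[R]_d -> \bar R}) :=
  forall (i : 'I_d) (c : R), mu.-caratheodory [set x | x ord0 i <= c].

Lemma hausdorff_halfspaces (R : realType) d n :
  halfspaces_measurable (@hausdorff R d n).
Proof.
move=> i c; apply: (@separated_sublevel_caratheodory R _ (hausdorff d n)
  (fun x => x ord0 i)).
by move=> a b X Y ab; exact: hausdorff_separated.
Qed.

Section lebesgue_halfspace.
Local Open Scope ereal_scope.
Context {R : realType} (d : nat).

Definition set_coord (x : 'rV[R]_d.+1) (i : 'I_d.+1) (c : R) : 'rV[R]_d.+1 :=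
  \row_j if j == i then c else x ord0 j.

(** The hyperplane x_i = c cuts a box into two boxes, one of which is degenerate
if the hyperplane misses the box; cutting every box of a cover makes half-spaces
measurable for the Lebesgue outer measure. *)
Lemma box_vol_split (ab : 'rV[R]_d.+1 * 'rV[R]_d.+1) i c :
  box_vol (ab.1, set_coord ab.2 i (Num.min (ab.2 ord0 i) c)) +
  box_vol (set_coord ab.1 i (Num.max (ab.1 ord0 i) c), ab.2) = box_vol ab.
Proof.
rewrite /box_vol -EFinD; congr _%:E.
have D1 (F : 'I_d.+1 -> R) : (\prod_j F j = F i * \prod_(j | j != i) F j)%R.
  by rewrite (bigD1 i).
rewrite !D1 !mxE eqxx /=.
under [X in (_ * X + _)%R]eq_bigr => j ji do rewrite !mxE (negbTE ji).
under [X in (_ + _ * X)%R]eq_bigr => j ji do rewrite !mxE (negbTE ji).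
rewrite -mulrDl; congr (_ * _)%R.
move: (ab.1 _ _) (ab.2 _ _) => a b.
have [bc|cb] := leP b c; have [ac|ca] := leP a c;
  by repeat match goal with |- context [Num.max ?x 0%R] =>
    case: (leP x 0%R) => ? end; lra.
Qed.

Lemma lebesgue_halfspaces : halfspaces_measurable (@lebesgue R d).
Proof.
move=> i c; apply: le_caratheodory_measurable => Z.
apply: le_ereal_inf_tmp => _ [ab Zab <-].
pose lo k := ((ab k).1, set_coord (ab k).2 i (Num.min ((ab k).2 ord0 i) c)).
pose hi k := (set_coord (ab k).1 i (Num.max ((ab k).1 ord0 i) c), (ab k).2).
have vol_ge0 B : 0 <= @box_vol R d B.
  by rewrite lee_fin; apply: prodr_ge0 => j _; rewrite le_max lexx orbT.
rewrite -(eq_eseriesr (fun k _ => box_vol_split (ab k) i c)) nneseriesD//.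
apply: leeD; apply: ereal_inf_lbound.
  exists lo => //= x [/Zab[k _ xk] /= xc]; exists k => // j.
  rewrite /lo /= mxE; case: eqP => [->|_]; last exact: xk.
  by have /andP[-> xb] := xk i; rewrite le_min xb.
exists hi => //= x [/Zab[k _ xk] /= /negP]; rewrite -ltNge => cx.
exists k => // j; rewrite /hi /= mxE; case: eqP => [->|_]; last exact: xk.
by have /andP[xa ->] := xk i; rewrite ge_max xa ltW.
Qed.

End lebesgue_halfspace.

Section halfspaces.
Context {R : realType} {d : nat}.
Variable mu : {outer_measure set 'rV[R]_d -> \bar R}.
Hypothesis mu_half : halfspaces_measurable mu.
Local Notation T := (caratheodory_type mu).

Lemma measurable_coord (D : set T) i :
  measurable_fun D (fun x : T => (x : 'rV[R]_d) ord0 i).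
Proof.
apply: (@measurable_funS _ _ _ _ setT) => //.
apply: (measurability _ (RGenOInfty.measurableE R)).
move=> _ [_ [c ->] <-]; rewrite setTI.
have -> : (fun x : T => (x : 'rV[R]_d) ord0 i) @^-1` `]c, +oo[%classic =
    ~` [set x : 'rV[R]_d | x ord0 i <= c].
  by apply/seteqP; split => x /=; rewrite in_itv/= andbT ltNge => /negP.
exact/measurableC/mu_half.
Qed.

(** Balls of the space of rows are cubes, so an open set is the union of the
countably many cubes with rational centre and radius that it contains. *)
Lemma open_caratheodory (U : set 'rV[R]_d) : open U -> mu.-cara.-measurable U.
Proof.
move=> oU.
pose cube (qr : 'rV[rat]_d * rat) : set 'rV[R]_d :=
  [set x | forall j, `|x ord0 j - ratr (qr.1 ord0 j)| <= ratr qr.2].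
pose F qr := if `[< (cube qr `<=` U) >] then cube qr else set0.
have -> : U = \bigcup_qr F qr.
  apply/seteqP; split => [x Ux|x [qr _]]; last first.
    by rewrite /F; case: asboolP => // cU; exact: cU.
  have /nbhs_ballP[e /= e0 xeU] : nbhs x U by exact: open_nbhs_nbhs.
  have /rat_in_itvoo[r] : 0 < e / 2 by rewrite divr_gt0.
  rewrite in_itv/= => /andP[r0 re].
  have ex_q j : exists q : rat, `|x ord0 j - ratr q| <= ratr r.
    have /rat_in_itvoo[q] : x ord0 j - ratr r < x ord0 j + ratr r by lra.
    by rewrite in_itv/= => /andP[? ?]; exists q; rewrite ler_norml; lra.
  pose q : 'rV[rat]_d := \row_j xget 0 [set q : rat | `|x ord0 j - ratr q| <= ratr r].
  have xq j : `|x ord0 j - ratr (q ord0 j)| <= ratr r.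
    by rewrite mxE; case: xgetP => [y -> //|/(_ _)]; have [z zP] := ex_q j => /(_ z).
  exists (q, r) => //; rewrite /F; case: asboolP => [//|]; case.
  move=> y /= yq; apply: xeU; split=> // i j; rewrite /ball/= ord1.
  have := xq j; have := yq j; rewrite !ler_norml => /andP[? ?] /andP[? ?].
  by rewrite ltr_norml; lra.
apply: countable_bigcupT_measurable => [|qr]; first exact: countableP.
rewrite /F; case: asboolP => // _.
have -> : cube qr = \bigcap_(j in [set: 'I_d])
    ((fun x : T => (x : 'rV[R]_d) ord0 j) @^-1`
      `[ratr (qr.1 ord0 j) - ratr qr.2, ratr (qr.1 ord0 j) + ratr qr.2]%classic).
  apply/seteqP; split => x /= xq j => [_|]; last have := xq j I;
    rewrite /= in_itv/=; [have := xq j; rewrite ler_norml|rewrite ler_norml];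
    by lra.
apply: fin_bigcap_measurable => // j _; rewrite -[X in measurable X]setTI.
exact: measurable_coord.
Qed.

Lemma closed_caratheodory (F : set 'rV[R]_d) :
  closed F -> mu.-cara.-measurable F.
Proof.
by move=> cF; rewrite -[F]setCK; apply: measurableC; apply: open_caratheodory;
  exact: closed_openC.
Qed.

End halfspaces.

(** * Measurable matrices, square integrability and tensor forms *)

Section measurable_matrices.
Context {d} {T : measurableType d} {R : realType}.
Variable D : set T.
Implicit Types f g : T -> R.

Lemma measurable_fun_sqrt f : measurable_fun D f ->
  measurable_fun D (fun x => Num.sqrt (f x)).
Proof.
move=> mf; apply: (measurableT_comp (f := @Num.sqrt R)) => //.
by apply: nondecreasing_measurable => // x y *; exact: ler_wsqrtr.
Qed.

(** Inversion is a power function on nonnegative numbers; the square removes the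
sign and the singularity at 0 is harmless because 0^-1 = 0. *)
Lemma measurable_fun_inv f : measurable_fun D f ->
  measurable_fun D (fun x => (f x)^-1).
Proof.
move=> mf; have -> : (fun x => (f x)^-1) = fun x => f x * (f x ^+ 2) `^ (-1).
  apply/funext => x; rewrite powR_inv1 ?sqr_ge0//.
  have [->|fx0] := eqVneq (f x) 0; first by rewrite mul0r invr0.
  by rewrite expr2 invfM mulrA divff// mul1r.
apply: measurable_funM => //.
apply: (measurableT_comp (f := fun a => a `^ (-1))); first exact: measurable_powR.
exact: measurable_funX.
Qed.

Definition measurable_mx m n (M : T -> 'M[R]_(m, n)) :=
  forall i j, measurable_fun D (fun x => M x i j).

Lemma measurable_mx_mul m n p (M : T -> 'M[R]_(m, n)) (P : T -> 'M[R]_(n, p)) :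
  measurable_mx M -> measurable_mx P -> measurable_mx (fun x => M x *m P x).
Proof.
move=> mM mP i j; under eq_fun do rewrite mxE.
by apply: measurable_sum => k; exact: measurable_funM.
Qed.

Lemma measurable_mx_tr m n (M : T -> 'M[R]_(m, n)) :
  measurable_mx M -> measurable_mx (fun x => (M x)^T).
Proof. by move=> mM i j; under eq_fun do rewrite mxE; exact: mM. Qed.

Lemma measurable_mx_cst m n (M : 'M[R]_(m, n)) : measurable_mx (fun=> M).
Proof. by move=> i j; exact: measurable_cst. Qed.

Lemma measurable_trace n (M : T -> 'M[R]_n) :
  measurable_mx M -> measurable_fun D (fun x => \tr (M x)).
Proof. by move=> mM; apply: measurable_sum => i; exact: mM. Qed.

Lemma measurable_edot m n (M P : T -> 'M[R]_(m, n)) :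
  measurable_mx M -> measurable_mx P ->
  measurable_fun D (fun x => edot (M x) (P x)).
Proof.
move=> mM mP; apply: measurable_sum => i; apply: measurable_sum => j.
exact: measurable_funM.
Qed.

Lemma measurable_enorm m n (M : T -> 'M[R]_(m, n)) :
  measurable_mx M -> measurable_fun D (fun x => enorm (M x)).
Proof. by move=> mM; apply/measurable_fun_sqrt/measurable_edot. Qed.

Lemma measurable_det n (M : T -> 'M[R]_n) :
  measurable_mx M -> measurable_fun D (fun x => \det (M x)).
Proof.
move=> mM; apply: measurable_sum => s; apply: measurable_funM => //.
by apply: measurable_prod => i _; exact: mM.
Qed.

Lemma measurable_mx_inv n (M : T -> 'M[R]_n) : measurable D ->
  measurable_mx M -> measurable_mx (fun x => invmx (M x)).
Proof.
move=> mD mM i j.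
have -> : (fun x => invmx (M x) i j) = fun x => if \det (M x) == 0 then M x i j
    else (\det (M x))^-1 * cofactor (M x) j i.
  apply/funext => x; rewrite /invmx unitmxE unitfE.
  by case: eqP => //= _; rewrite !mxE.
apply: measurable_fun_if => //.
- by apply: measurable_fun_eqr => //; exact: measurable_det.
- exact: measurable_funS (mM i j).
apply: (@measurable_funS _ _ _ _ D) => //.
apply: measurable_funM; first by apply/measurable_fun_inv/measurable_det.
apply: measurable_funM => //; apply: measurable_sum => s.
apply: measurable_funM => //; apply: measurable_prod => k _.
by under eq_fun do rewrite !mxE; exact: mM.
Qed.

Lemma measurable_inv_form n (M : T -> 'M[R]_n) (u v : T -> 'rV[R]_n) :
  measurable D -> measurable_mx M -> measurable_mx u -> measurable_mx v ->
  measurable_fun D (fun x => inv_form (M x) (u x) (v x)).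
Proof.
move=> mD mM mu mv; apply: measurable_edot; last exact: measurable_mx_tr.
by apply: measurable_mx_mul; [exact: measurable_mx_inv|exact: measurable_mx_tr].
Qed.

End measurable_matrices.

Section square_integrable.
Context {d} {T : measurableType d} {R : realType}.
Variables (mu : {measure set T -> \bar R}) (D : set T).
Hypothesis mD : measurable D.
Implicit Types f g : T -> R.

(** Integrals of functions that are not integrable take conventional values, so
each use of linearity or monotonicity below goes through this predicate. *)
Definition sqint f := measurable_fun D f /\
  mu.-integrable D (EFin \o (fun x => f x ^+ 2)).

Definition l2norm f := Num.sqrt (L2prod mu D f f).

Lemma L2prod_ge0 f : 0 <= L2prod mu D f f.
Proof. by apply: Rintegral_ge0 => x _; rewrite -expr2 sqr_ge0. Qed.

Lemma L2prodC f g : L2prod mu D f g = L2prod mu D g f.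
Proof. by apply: eq_Rintegral => x _; rewrite mulrC. Qed.

Lemma l2norm_ge0 f : 0 <= l2norm f.
Proof. exact: sqrtr_ge0. Qed.

Lemma sqr_l2norm f : l2norm f ^+ 2 = L2prod mu D f f.
Proof. by rewrite sqr_sqrtr// L2prod_ge0. Qed.

Lemma integral_sqr f : sqint f ->
  (\int[mu]_(x in D) (f x ^+ 2)%:E)%E = (L2prod mu D f f)%:E.
Proof.
move=> [_ iff]; rewrite -[LHS]fineK; last exact: integrable_fin_num.
by congr _%:E; apply: eq_Rintegral => x _; rewrite expr2.
Qed.

Lemma L2normE f : sqint f -> L2norm mu D f = (l2norm f)%:E.
Proof.
by move=> sf; rewrite /L2norm integral_sqr// poweR_EFin powR12_sqrt// L2prod_ge0.
Qed.

Lemma lty_sqint f : measurable_fun D f ->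
  (\int[mu]_(x in D) (f x ^+ 2)%:E < +oo)%E -> sqint f.
Proof.
move=> mf foo; split => //; apply/integrableP; split.
  exact/measurable_EFinP/measurable_funX.
under eq_integral do rewrite /= ger0_norm ?sqr_ge0//; exact: foo.
Qed.

Lemma L2norm_lty_sqint f : measurable_fun D f -> (L2norm mu D f < +oo)%E -> sqint f.
Proof. by move=> mf /lty_poweRy => /(_ _)/lty_sqint; apply. Qed.

Lemma bounded_sqint f B : (mu D < +oo)%E -> measurable_fun D f ->
  (forall x, D x -> `|f x| <= B) -> sqint f.
Proof.
move=> Doo mf fB; split => //; apply: measurable_bounded_integrable => //.
  exact: measurable_funX.
exists (B ^+ 2); split; first exact: num_real.
move=> M BM x Dx /=; rewrite normrX (le_trans _ (ltW BM))//.
by rewrite lerXn2r ?nnegrE// ?fB// (le_trans _ (fB _ Dx)).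
Qed.

Lemma sqint_mul f g : sqint f -> sqint g ->
  mu.-integrable D (EFin \o (fun x => f x * g x)).
Proof.
move=> [mf iff] [mg igg].
have ifg : mu.-integrable D (EFin \o (fun x => f x ^+ 2 + g x ^+ 2)).
  exact: (integrableD mD iff igg).
apply: le_integrable ifg => //.
  exact/measurable_EFinP/measurable_funM.
move=> x Dx /=; rewrite lee_fin [leRHS]ger0_norm ?addr_ge0 ?sqr_ge0//.
rewrite normrM -(real_normK (num_real (f x))) -(real_normK (num_real (g x))).
by have := sqr_ge0 (`|f x| - `|g x|); have := sqr_ge0 (`|f x| + `|g x|); nra.
Qed.

Lemma sqintZ a f : sqint f -> sqint (fun x => a * f x).
Proof.
move=> [mf iff]; split; first exact: measurable_funM.
under [X in _ \o X]eq_fun do rewrite exprMn.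
exact: (integrableZl mD (a ^+ 2) iff).
Qed.

Lemma sqint_norm f : sqint f -> sqint (fun x => `|f x|).
Proof.
move=> [mf iff]; split; first exact: measurableT_comp.
by under [X in _ \o X]eq_fun do rewrite real_normK ?num_real//.
Qed.

Lemma L2prod_norm f : L2prod mu D (fun x => `|f x|) (fun x => `|f x|) =
  L2prod mu D f f.
Proof.
by apply: eq_Rintegral => x _; rewrite -!expr2 real_normK ?num_real.
Qed.

Lemma L2prod_CS_le f g : sqint f -> sqint g ->
  L2prod mu D f g <= l2norm f * l2norm g.
Proof.
move=> sf sg; apply: weighted_bound_CS => [||t t0]; rewrite ?L2prod_ge0//.
have iff := sqint_mul sf sf; have igg := sqint_mul sg sg.
have ifg := sqint_mul sf sg.
rewrite -!RintegralZl// -RintegralD//; last 2 first.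
- exact: (integrableZl mD t iff).
- exact: (integrableZl mD t^-1 igg).
apply: le_Rintegral => //.
- exact: (integrableZl mD 2 ifg).
- exact: (integrableD mD (integrableZl mD t iff) (integrableZl mD t^-1 igg)).
move=> x _; rewrite -(ler_pM2l t0) mulrDr !mulrA divff ?gt_eqF// mul1r.
by have := sqr_ge0 (t * f x - g x); nra.
Qed.

Lemma L2prod_CS f g : sqint f -> sqint g ->
  `|L2prod mu D f g| <= l2norm f * l2norm g.
Proof.
move=> sf sg; apply: le_trans (le_normr_Rintegral mD (sqint_mul sf sg)) _.
rewrite (@eq_Rintegral _ _ _ mu D (fun x => `|f x| * `|g x|)); last first.
  by move=> x _; rewrite normrM.
rewrite (_ : l2norm f = l2norm (fun x => `|f x|)).
  rewrite (_ : l2norm g = l2norm (fun x => `|g x|)).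
    by apply: L2prod_CS_le; exact: sqint_norm.
  by congr Num.sqrt; rewrite L2prod_norm.
by congr Num.sqrt; rewrite L2prod_norm.
Qed.

Lemma le_ae_Rintegral f g : mu.-integrable D (EFin \o f) ->
  mu.-integrable D (EFin \o g) -> {ae mu, forall x, D x -> f x <= g x} ->
  \int[mu]_(x in D) f x <= \int[mu]_(x in D) g x.
Proof.
move=> intf intg [N [mN N0 fgN]].
rewrite /Rintegral !(negligible_integral mN mD _ N0)//.
have mDN : measurable (D `\` N) by exact: measurableD.
have sDN : D `\` N `<=` D by exact: subDsetl.
apply: le_Rintegral => //; [exact: integrableS sDN intf|exact: integrableS sDN intg|].
by move=> x [Dx Nx]; apply: contrapT => fgx; apply/Nx/fgN => /= /(_ Dx).
Qed.

Lemma le_ae_integrable f g : measurable_fun D f ->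
  mu.-integrable D (EFin \o g) -> {ae mu, forall x, D x -> `|f x| <= g x} ->
  mu.-integrable D (EFin \o f).
Proof.
move=> mf intg [N [mN N0 fgN]].
have mDN : measurable (D `\` N) by exact: measurableD.
apply/(negligible_integrable mN mD _ N0); first exact/measurable_EFinP.
have sDN : D `\` N `<=` D by exact: subDsetl.
apply: le_integrable (integrableS mD mDN sDN intg) => //.
  exact/measurable_EFinP/(measurable_funS mD sDN).
move=> x [Dx Nx] /=; rewrite lee_fin (le_trans _ (ler_norm _))//.
by apply: contrapT => fgx; apply/Nx/fgN => /= /(_ Dx).
Qed.

End square_integrable.

Section tensor_forms.
Context {d} {T : measurableType d} {R : realType}.
Variables (mu : {measure set T -> \bar R}) (D : set T).
Hypothesis mD : measurable D.
Variables (k : nat) (M : T -> 'M[R]_k) (c C : R).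
Hypothesis hM : tensor_bounds mu D M c C.
Implicit Types u v : T -> 'rV[R]_k.

Let M_inv_le u v : {ae mu, forall x, D x ->
  `|inv_form (M x) (u x) (v x)| <= `|C| * (enorm (u x) * enorm (v x))}.
Proof.
apply: filterS hM.2 => x + Dx => /(_ Dx)[_ MC].
apply: le_trans (edot_le _ _) _; rewrite mulrA.
have -> : enorm (v x)^T = enorm (v x).
  by congr Num.sqrt; rewrite !edotE trmxK mxtrace_mulC.
rewrite ler_wpM2r ?enorm_ge0//; apply: le_trans (MC _).2 _.
by rewrite ler_wpM2r ?enorm_ge0// ler_norm.
Qed.

Let sqint_bound u v : sqint mu D (fun x => enorm (u x)) ->
  sqint mu D (fun x => enorm (v x)) ->
  mu.-integrable D (EFin \o (fun x => `|C| * (enorm (u x) * enorm (v x)))).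
Proof.
by move=> su sv; exact: (integrableZl mD `|C| (sqint_mul mD su sv)).
Qed.

Lemma integrable_inv_form u v : measurable_mx D u -> measurable_mx D v ->
  sqint mu D (fun x => enorm (u x)) -> sqint mu D (fun x => enorm (v x)) ->
  mu.-integrable D (EFin \o (fun x => inv_form (M x) (u x) (v x))).
Proof.
move=> mfu mv su sv; apply: le_ae_integrable (M_inv_le u v) => //.
  by apply: measurable_inv_form => //; exact: hM.1.
exact: sqint_bound.
Qed.

Lemma inv_form_upper u v : measurable_mx D u -> measurable_mx D v ->
  sqint mu D (fun x => enorm (u x)) -> sqint mu D (fun x => enorm (v x)) ->
  `|\int[mu]_(x in D) inv_form (M x) (u x) (v x)| <=
  `|C| * (l2norm mu D (fun x => enorm (u x)) * l2norm mu D (fun x => enorm (v x))).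
Proof.
move=> mfu mv su sv; have iM := integrable_inv_form mfu mv su sv.
apply: le_trans (le_normr_Rintegral mD iM) _.
apply: (@le_trans _ _
  (\int[mu]_(x in D) (`|C| * (enorm (u x) * enorm (v x))))).
  apply: le_ae_Rintegral (M_inv_le u v) => //; last exact: sqint_bound.
  exact: integrable_norm.
rewrite RintegralZl//; last exact: sqint_mul.
rewrite ler_wpM2l//; exact: L2prod_CS_le.
Qed.

Lemma inv_form_lower u : measurable_mx D u ->
  sqint mu D (fun x => enorm (u x)) ->
  c * l2norm mu D (fun x => enorm (u x)) ^+ 2 <=
  \int[mu]_(x in D) inv_form (M x) (u x) (u x).
Proof.
move=> mfu su; have iM := integrable_inv_form mfu mfu su su.
rewrite sqr_l2norm -RintegralZl//; last exact: sqint_mul.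
apply: le_ae_Rintegral => //; first exact: (integrableZl mD c (sqint_mul mD su su)).
by apply: filterS hM.2 => x + Dx => /(_ Dx)[_ /(_ (u x))[]]; rewrite expr2.
Qed.

(** No integrability is available yet where this is used: it is what allows one
to conclude from a finite sum of three energies that each of them is finite. The
integrand is nonnegative only almost everywhere, hence the detour through its
absolute value. *)
Lemma integral_inv_form_ge0 u : 0 <= c -> measurable_mx D u ->
  (0 <= \int[mu]_(x in D) (inv_form (M x) (u x) (u x))%:E)%E.
Proof.
move=> c0 mfu; have mM := measurable_inv_form mD hM.1 mfu mfu.
rewrite (ae_eq_integral (fun x => `|inv_form (M x) (u x) (u x)|%:E))//.
- by apply: integral_ge0 => x _; rewrite lee_fin.
- exact/measurable_EFinP.
- exact/measurable_EFinP/measurableT_comp.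
apply: filterS hM.2 => x + Dx => /(_ Dx)[_ /(_ (u x))[Mc _]].
by rewrite ger0_norm// (le_trans _ Mc)// mulr_ge0// sqr_ge0.
Qed.

End tensor_forms.

(** * Mesh elements and piecewise affine fields *)

Section elements.
Context {R : realType} {k d : nat}.
Implicit Types (T : cell R k d) (x : 'rV[R]_d) (t : 'rV[R]_k).

Lemma gram_unitmx (E : 'M[R]_(k, d)) : row_free E -> E *m E^T \in unitmx.
Proof.
move=> Efree; rewrite -row_free_unit -kermx_eq0; apply/rowV0P => v.
move=> /sub_kermxP vE0; apply: (row_free_inj Efree); rewrite mul0mx.
apply/eqP; rewrite -edot_eq0 edotE trmx_mul mulmxA -(mulmxA v) vE0 mul0mx.
by rewrite mxtrace0.
Qed.

Lemma coord_of_elt_map T t : Defs.nondegenerate T -> coord_of T (elt_map T t) = t.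
Proof.
move=> [Tfree _]; rewrite /coord_of /elt_map addrAC subrr add0r -!mulmxA.
by rewrite (mulmxA (edges T)) mulmxV ?mulmx1// gram_unitmx.
Qed.

(** Membership in an element, defined by an existential quantifier over the
reference coordinates, becomes a finite list of conditions on measurable
functions of x once these coordinates are recovered by projection. *)
Lemma closed_cellE T x : Defs.nondegenerate T ->
  closed_cell T x <->
  elt_map T (coord_of T x) = x /\ forall f, 0 <= slack T f (coord_of T x).
Proof.
move=> ndT; split=> [[t tT <-]|[xE xT]]; first by rewrite coord_of_elt_map.
by exists (coord_of T x).
Qed.

Lemma closed_cell_coord_le1 T t : (forall f, 0 <= slack T f t) ->
  forall i, 0 <= t ord0 i <= 1.
Proof.
move=> tT i; have t0 j : 0 <= t ord0 j by exact: tT (true, j).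
rewrite t0 /=; have := tT (false, i); rewrite /slack /=.
case: simplicial; rewrite subr_ge0// (bigD1 i)//=.
by apply: le_trans; rewrite lerDl sumr_ge0.
Qed.

Lemma ler_abs_mulmx (t : 'rV[R]_k) (E : 'M[R]_(k, d)) B j :
  (forall i, `|t ord0 i| <= B) ->
  `|(t *m E) ord0 j| <= \sum_i B * `|E i j|.
Proof.
move=> tB; rewrite mxE (le_trans (ler_norm_sum _ _ _))// ler_sum// => i _.
by rewrite normrM ler_wpM2r.
Qed.

Lemma ler_enorm m n (A B : 'M[R]_(m, n)) :
  (forall i j, `|A i j| <= B i j) -> enorm A <= enorm B.
Proof.
move=> AB; rewrite ler_wsqrtr// ler_sum// => i _; rewrite ler_sum// => j _.
rewrite -!expr2 -(real_normK (num_real (A i j))) lerXn2r ?nnegrE//.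
exact: le_trans (AB i j).
Qed.

End elements.

(** A nondegenerate element contains the two ends of its first edge. *)
Lemma cdiam_gt0 (R : realType) k d (T : cell R k.+1 d) :
  Defs.nondegenerate T -> 0 < cdiam (closed_cell T).
Proof.
move=> [Tfree _].
have E0 : row ord0 (edges T) != 0.
  apply/eqP => E0; have : delta_mx ord0 ord0 = 0 :> 'rV[R]_k.+1.
    by apply: (row_free_inj Tfree); rewrite mul0mx -rowE.
  by move/matrixP/(_ ord0 ord0)/eqP; rewrite !mxE !eqxx oner_eq0.
apply: (@lt_le_trans _ _ (enorm (row ord0 (edges T)))).
  by rewrite lt_neqAle enorm_ge0 andbT eq_sym enorm_eq0.
apply: ub_le_sup.
  exists (enorm (\row_j \sum_i 1 * `|edges T i j|)) => _ [_ [t tT <-]]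
    [_ [s sT <-] <-].
  apply: ler_enorm => a j; rewrite !ord1 [leRHS]mxE.
  rewrite /elt_map opprD addrACA subrr add0r -mulmxBl.
  apply: ler_abs_mulmx => i; rewrite !mxE.
  have /andP[? ?] := closed_cell_coord_le1 tT i.
  have /andP[? ?] := closed_cell_coord_le1 sT i.
  by rewrite ler_norml; lra.
have vertex t : (t = 0 \/ t = delta_mx ord0 ord0) -> closed_cell T (elt_map T t).
  move=> t01; exists t => // -[[] j] /=; rewrite /slack /=.
    by case: t01 => ->; rewrite !mxE.
  case: t01 => ->; case: simplicial.
  - by rewrite big1 ?subr0// => i _; rewrite mxE.
  - by rewrite mxE subr0.
  - rewrite (bigD1 ord0)//= big1 ?mxE ?eqxx ?addr0 ?subrr// => i i0.
    by rewrite mxE (negbTE i0) andbF.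
  - by rewrite mxE subr_ge0; case: (_ && _).
exists (elt_map T (delta_mx ord0 ord0)); first by apply: vertex; right.
exists (elt_map T 0); first by apply: vertex; left.
by rewrite /elt_map mul0mx addr0 addrAC subrr add0r rowE.
Qed.

Lemma mesh_size_gt0 (R : realType) k d (m : mesh R k.+1 d)
    (j : 'I_(ncell m)) :
  (forall j, Defs.nondegenerate (mcell m j)) -> 0 < mesh_size m.
Proof.
move=> nd; apply: (@lt_le_trans _ _ (cdiam (closed_cell (mcell m j)))).
  exact: cdiam_gt0.
exact: (le_bigmax _ (fun j => cdiam (closed_cell (mcell m j)))).
Qed.

Section affine_maps.
Context {R : realType} {d p : nat}.
Implicit Types (u : 'rV[R]_d -> 'rV[R]_p).

Definition affine_map u := exists (c : 'rV[R]_p) (B : 'M[R]_(d, p)),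
  forall x, u x = c + x *m B.

Lemma ler_coord_norm (x : 'rV[R]_d) i : `|x ord0 i| <= `|x|.
Proof.
rewrite [leRHS]/Num.Def.normr/= mx_normrE.
exact: (le_bigmax _ (fun ij => `|x ij.1 ij.2|) (ord0, i)).
Qed.

Lemma mulmxr_continuous (B : 'M[R]_(d, p)) :
  continuous (mulmxr B : 'rV[R]_d -> 'rV[R]_p).
Proof.
apply: bounded_linear_continuous; apply/linear_boundedP.
near=> r => x; rewrite [leLHS]/Num.Def.normr/= mx_normrE.
have S0 : 0 <= \sum_i \sum_j `|B i j|.
  by apply: sumr_ge0 => i _; apply: sumr_ge0.
apply: (@le_trans _ _ ((\sum_i \sum_j `|B i j|) * `|x|)); last first.
  by rewrite ler_wpM2r//; near: r; exact: nbhs_pinfty_ge.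
apply/bigmax_leP; split=> [|[i j] _ /=]; first by rewrite mulr_ge0.
rewrite ord1; apply: le_trans (ler_abs_mulmx _ _ (ler_coord_norm x)) _.
rewrite -mulr_sumr mulrC ler_wpM2r// ler_sum// => l _.
by rewrite (bigD1 j)//= lerDl sumr_ge0.
Unshelve. all: by end_near. Qed.

Lemma jacobian_affine u c B x : (forall x, u x = c + x *m B) ->
  jacobian u x = B.
Proof.
move=> uE; have -> : u = (fun=> c) + (mulmxr B : 'rV[R]_d -> 'rV[R]_p).
  by apply/funext => y; rewrite uE.
have dE : 'd ((fun=> c) + (mulmxr B : 'rV[R]_d -> 'rV[R]_p)) x = mulmxr B :> (_ -> _).
  have H1 : 'd (fun=> c : 'rV[R]_p) x = (fun=> 0) :> ('rV[R]_d -> _).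
    by rewrite diff_cst.
  have H2 : 'd (mulmxr B : 'rV[R]_d -> 'rV[R]_p) x = mulmxr B :> (_ -> _).
    exact/diff_lin/mulmxr_continuous.
  have dB : differentiable (mulmxr B : 'rV[R]_d -> 'rV[R]_p) x.
    exact/linear_differentiable/mulmxr_continuous.
  have H0 := diffD (differentiable_cst c x) dB.
  apply: (etrans H0); apply/funext => v; rewrite -[RHS]add0r.
  exact: (f_equal2 (fun a b => a + b) (congr1 (@^~ v) H1) (congr1 (@^~ v) H2)).
by apply/matrixP => i j; rewrite /jacobian mxE dE /= -rowE mxE.
Qed.

Lemma bounded_affine u (b : R) : affine_map u ->
  exists B, forall x : 'rV[R]_d, (forall i, `|x ord0 i| <= b) -> forall j, `|u x ord0 j| <= B.
Proof.
move=> [c [B uE]].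
exists (\sum_j (`|c ord0 j| + \sum_i b * `|B i j|)) => x xb j.
rewrite uE mxE (le_trans (ler_normD _ _))//.
rewrite (bigD1 j)//= -[leLHS]addr0 lerD//; first by rewrite lerD2l ler_abs_mulmx.
apply: sumr_ge0 => l _; rewrite addr_ge0// sumr_ge0// => i _.
by rewrite mulr_ge0// (le_trans _ (xb i)).
Qed.

End affine_maps.

Lemma local_RT0_affine (R : realType) k d (T : cell R k d) u :
  local_RT0 T u -> affine_map u.
Proof.
move=> [w [b [_ uE]]].
set M := (edges T)^T *m invmx (edges T *m (edges T)^T).
exists ((w - corner T *m M *m diag_mx b) *m edges T), (M *m diag_mx b *m edges T).
move=> x; rewrite uE /coord_of -!mulmxA -/M mulmxA mulmxBl !mulmxDl.
by rewrite !mulNmx !mulmxA; rewrite -!addrA; congr (_ + _); rewrite addrC.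
Qed.

Section RT0_linear.
Context {R : realType} {k d : nat}.
Variables (D : set 'rV[R]_d) (m : mesh R k d).

(** With N = 0 this also gives the membership of the zero field. *)
Lemma RT0_combination N (c : 'I_N -> R) (u : 'I_N -> vfield m) :
  (forall i, RT0 D (u i)) ->
  RT0 D ((fun j x => \sum_i c i *: u i j x) : vfield m).
Proof.
move=> uRT; split=> [j|j j' f f' ff' x nu fx Dx nuE].
  have /(_ _)/cid-/all_sig[w wP] := fun i => (uRT i).1 j.
  have /(_ _)/cid-/all_sig[b bP] := wP.
  exists (\sum_i c i *: w i), (\sum_i c i *: b i); split=> [sT i i'|x].
    by rewrite !summxE; apply: eq_bigr => l _; rewrite !mxE ((bP l).1 sT i i').
  rewrite linear_sum /= mulmx_sumr -big_split mulmx_suml; apply: eq_bigr => i _.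
  by rewrite (bP i).2 linearZ/= -scalemxAr -scalerDr -scalemxAl.
rewrite !edotE !mulmx_suml !raddf_sum; apply: eq_bigr => i _ /=.
by rewrite -!edotE !edotZl ((uRT i).2 _ _ _ _ ff').
Qed.

End RT0_linear.

Section glued_functions.
Context {R : realType} {k d : nat}.
Variable mu : {outer_measure set 'rV[R]_d -> \bar R}.
Hypothesis mu_half : halfspaces_measurable mu.
Local Notation T := (caratheodory_type mu).
Variable m : mesh R k d.
Hypothesis nd : forall j, Defs.nondegenerate (mcell m j).

Lemma measurable_mx_id (D : set T) : measurable_mx D (fun x : T => x : 'rV[R]_d).
Proof. by move=> i j; rewrite ord1; exact: measurable_coord. Qed.

Lemma measurable_mx_affine p (D : set T) (u : 'rV[R]_d -> 'rV[R]_p) :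
  affine_map u -> measurable_mx D (u : T -> _).
Proof.
move=> [c [B uE]] i j; under eq_fun do rewrite uE mxE.
apply: measurable_funD => //.
apply: (measurable_mx_mul (P := fun=> B)); first exact: measurable_mx_id.
exact: measurable_mx_cst.
Qed.

Lemma measurable_closed_cell j : measurable (closed_cell (mcell m j) : set T).
Proof.
set C := mcell m j.
have affine_coord : affine_map (coord_of C).
  exists (- corner C *m ((edges C)^T *m invmx (edges C *m (edges C)^T))),
    ((edges C)^T *m invmx (edges C *m (edges C)^T)) => x.
  by rewrite -mulmxDl addrC mulmxA.
have mcoord := measurable_mx_affine (D := [set: T]) affine_coord.
pose g (x : T) := enorm (elt_map C (coord_of C (x : 'rV[R]_d)) - (x : 'rV[R]_d)).
have mg : measurable_fun setT g.
  apply: measurable_enorm => a i; under eq_fun do rewrite mxE [X in _ + X]mxE mxE.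
  apply: measurable_funB; last exact: measurable_mx_id.
  apply: measurable_funD => //.
  exact: (measurable_mx_mul mcoord (@measurable_mx_cst _ T _ _ _ _ (edges C))).
have mslack f : measurable_fun setT (fun x : T => slack C f (coord_of C (x : 'rV[R]_d))).
  case: f => -[] i; rewrite /slack /=; first exact: mcoord.
  case: simplicial; apply: measurable_funB => //.
  by apply: measurable_sum => i'; exact: mcoord.
have -> : (closed_cell C : set T) = (g @^-1` [set 0]) `&`
    \bigcap_(f in [set: bool * 'I_k])
      ((fun x : T => slack C f (coord_of C (x : 'rV[R]_d))) @^-1` `[0, +oo[%classic).
  apply/seteqP; split=> x.
    move=> /(closed_cellE _ (nd j))[xE xs]; split.
      by rewrite /g /= xE; apply/eqP; rewrite enorm_eq0 subrr.
    by move=> f _; rewrite /= in_itv /= andbT.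
  move=> [/eqP gx xs]; apply/(closed_cellE _ (nd j)); split.
    by apply/eqP; rewrite -subr_eq0 -enorm_eq0.
  by move=> f; have := xs f I; rewrite /= in_itv /= andbT.
apply: measurableI.
  by rewrite -[X in measurable X]setTI; apply: mg.
apply: fin_bigcap_measurable => // f _; rewrite -[X in measurable X]setTI.
exact: mslack.
Qed.

(** The element in which a discrete function is evaluated depends only on the
set of elements that contain the point. There are finitely many such sets, and
the points with a given one form a measurable set, on which the function
coincides with a single piece. *)
Lemma measurable_glue (D : set T) (h : 'I_(ncell m) -> 'rV[R]_d -> R) :
  (forall j, measurable_fun D (h j : T -> R)) ->
  measurable_fun D (Defs.glue h : T -> R).
Proof.
move=> mh.
pose pattern (x : 'rV[R]_d) : {set 'I_(ncell m)} :=
  [set j | `[< closed_cell (mcell m j) x >]]%SET.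
pose E S : set T := [set x | pattern x = S].
pose g (S : {set 'I_(ncell m)}) x := if [pick j in S] is Some j then h j x else 0.
have -> : (Defs.glue h : T -> R) = fun x => \sum_S \1_(E S) x * g S x.
  apply/funext => x; rewrite (bigD1 (pattern x))//= big1 ?addr0.
    rewrite indicE mem_set// mul1r /Defs.glue /g.
    have -> // : [pick j | `[< closed_cell (mcell m j) x >]] = [pick j in pattern x].
    by apply: eq_pick => j; rewrite !inE.
  by move=> S Sx; rewrite indicE memNset ?mul0r// => xS; rewrite xS eqxx in Sx.
apply: measurable_sum => S; apply: measurable_funM; last first.
  by rewrite /g; case: pickP => [j _|_]; [exact: mh|exact: measurable_cst].
apply: measurable_indic.
have -> : E S = \bigcap_(j in [set: 'I_(ncell m)])
    (if j \in S then closed_cell (mcell m j) else ~` closed_cell (mcell m j)).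
  apply/seteqP; split=> x.
    by move=> <- j _; rewrite inE; case: asboolP.
  move=> xS; apply/setP => j; rewrite inE; have := xS j I.
  by case: ifP => _ xj; case: asboolP.
apply: fin_bigcap_measurable => // j _.
case: ifP => _; last apply: measurableC; exact: measurable_closed_cell.
Qed.

Lemma glueE p (f : 'I_(ncell m) -> 'rV[R]_d -> 'rV[R]_p) x i j :
  Defs.glue f x i j = Defs.glue (fun l y => f l y i j) x.
Proof. by rewrite /Defs.glue; case: pickP => // _; rewrite mxE. Qed.

Lemma measurable_mx_glue p (D : set T) (f : 'I_(ncell m) -> 'rV[R]_d -> 'rV[R]_p) :
  (forall j, affine_map (f j)) -> measurable_mx D (Defs.glue f : T -> _).
Proof.
move=> fA i j; under eq_fun do rewrite glueE.
by apply: measurable_glue => l; exact: measurable_mx_affine.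
Qed.

Lemma measurable_sval (D : set T) (q : sfield m) :
  measurable_fun D (Defs.sval q : T -> R).
Proof. by apply: measurable_glue => j; exact: measurable_cst. Qed.

Lemma bounded_glue p (f : 'I_(ncell m) -> 'rV[R]_d -> 'rV[R]_p) (b : R) :
  (forall j, affine_map (f j)) ->
  exists B, forall x : 'rV[R]_d, (forall i, `|x ord0 i| <= b) ->
    forall j, `|Defs.glue f x ord0 j| <= B.
Proof.
move=> fA; have /(_ _)/cid-/all_sig[B BP] := fun j => bounded_affine b (fA j).
exists (\sum_j `|B j|) => x xb i; rewrite /Defs.glue.
have S0 : 0 <= \sum_j `|B j| by apply: sumr_ge0.
case: pickP => [j _|_]; last by rewrite mxE normr0.
apply: le_trans (BP j x xb i) _; rewrite (bigD1 j)//= -[leLHS]addr0.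
by rewrite lerD ?ler_norm// sumr_ge0.
Qed.

Lemma sval1 x : (\bigcup_j closed_cell (mcell m j)) x ->
  Defs.sval ((fun=> 1) : sfield m) x = 1.
Proof.
move=> [j _ xj]; rewrite /Defs.sval /Defs.glue; case: pickP => // /(_ j).
by move/asboolP: xj => ->.
Qed.

End glued_functions.

(** * Condition number of a coercive matrix, vector fields in L2 *)

Section condition_number_bound.
Context {R : realType} {N : nat}.
Implicit Types (A : 'M[R]_N) (V W : 'cV[R]_N).

Lemma sup_le_nonneg (S : set R) M : 0 <= M -> (forall x, S x -> x <= M) ->
  sup S <= M.
Proof.
move=> M0 SM; have [->|/set0P S0] := eqVneq S set0; first by rewrite sup0.
exact: ge_sup.
Qed.

Lemma sup_ge_nonneg (S : set R) M : (forall x, S x -> x <= M) ->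
  (S !=set0 -> exists2 x, S x & 0 <= x) -> 0 <= sup S.
Proof.
move=> SM S0; have [->|/set0P/S0[x Sx x0]] := eqVneq S set0; first by rewrite sup0.
by apply: le_trans x0 _; apply: ub_le_sup => //; exists M.
Qed.

Lemma opnorm_bound A M : 0 <= M ->
  (forall V W, `|edot (A *m V) W| <= M * (enorm V * enorm W)) ->
  0 <= opnorm A <= M.
Proof.
move=> M0 AM.
have quot V W : V != 0 -> W != 0 ->
    edot (A *m V) W / (enorm V * enorm W) <= M.
  move=> V0 W0; have VW0 : 0 < enorm V * enorm W.
    by rewrite mulr_gt0// lt_neqAle enorm_ge0 andbT eq_sym enorm_eq0.
  by rewrite ler_pdivrMr// (le_trans (ler_norm _))// AM.
have inner V : V != 0 -> 0 <= sup [set edot (A *m V) W / (enorm V * enorm W) |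
    W in [set W | W != 0]] <= M.
  move=> V0; apply/andP; split; last first.
    by apply: sup_le_nonneg => // _ [W W0 <-]; exact: quot.
  apply: (@sup_ge_nonneg _ M) => [_ [W W0 <-]|_]; first exact: quot.
  have [AV|AV] := leP 0 (edot (A *m V) V).
    exists (edot (A *m V) V / (enorm V * enorm V)); first by exists V.
    by rewrite divr_ge0// mulr_ge0// enorm_ge0.
  exists (edot (A *m V) (- V) / (enorm V * enorm (- V))).
    by exists (- V) => //=; rewrite oppr_eq0.
  rewrite -scaleN1r edotZr mulN1r divr_ge0 ?oppr_ge0 ?(ltW AV)//.
  by rewrite mulr_ge0// enorm_ge0.
apply/andP; split; last first.
  by apply: sup_le_nonneg => // _ [V V0 <-]; have /andP[] := inner V V0.
apply: (@sup_ge_nonneg _ M) => [_ [V V0 <-]|[_ [V V0 _]]].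
  by have /andP[] := inner V V0.
exists (sup [set edot (A *m V) W / (enorm V * enorm W) | W in [set W | W != 0]]).
  by exists V.
by have /andP[] := inner V V0.
Qed.

(** For a coercive form the inverse is bounded by the reciprocal of the
coercivity constant, as in the lemma of Lax and Milgram. *)
Lemma coercive_cond A a M : 0 < a -> 0 <= M ->
  (forall V, a * enorm V ^+ 2 <= edot (A *m V) V) ->
  (forall V W, `|edot (A *m V) W| <= M * (enorm V * enorm W)) ->
  A \in unitmx /\ cond A <= M / a.
Proof.
move=> a0 M0 coer bnd.
have lower V : a * enorm V <= enorm (A *m V).
  have [V0|V0] := eqVneq (enorm V) 0; first by rewrite V0 mulr0 enorm_ge0.
  have V1 : 0 < enorm V by rewrite lt_neqAle eq_sym V0 enorm_ge0.
  rewrite -(ler_pM2r V1) -mulrA -expr2 (le_trans (coer V))//.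
  exact: le_trans (ler_norm _) (edot_le _ _).
have Au : A \in unitmx.
  rewrite -unitmx_tr -row_free_unit -kermx_eq0; apply/rowV0P => v.
  move=> /sub_kermxP vA; have AvT : A *m v^T = 0.
    by rewrite -[A]trmxK -trmx_mul vA trmx0.
  have := lower v^T; rewrite AvT.
  have /eqP -> : enorm (0 : 'cV[R]_N) == 0 by rewrite enorm_eq0.
  rewrite pmulr_rle0// => v0; apply/eqP; rewrite -trmx_eq0 -enorm_eq0.
  by rewrite eq_le v0 enorm_ge0.
split=> //; have /andP[nA0 nAM] := opnorm_bound M0 bnd.
have /andP[nV0 nVa] : 0 <= opnorm (invmx A) <= a^-1.
  apply: opnorm_bound => [|V W]; first by rewrite invr_ge0 ltW.
  apply: le_trans (edot_le _ _) _; rewrite mulrA ler_wpM2r ?enorm_ge0//.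
  by rewrite ler_pdivlMl// (le_trans (lower _))// mulmxA mulmxV// mul1mx.
by rewrite /cond ler_pM.
Qed.

End condition_number_bound.

Section vector_fields_L2.
Context {d} {T : measurableType d} {R : realType}.
Variables (mu : {measure set T -> \bar R}) (D : set T).
Hypothesis mD : measurable D.
Context {k : nat}.
Implicit Types u v : T -> 'rV[R]_k.
Local Notation nrm u := (l2norm mu D (fun x => enorm (u x))).

Lemma L2prodv_sqr u : L2prodv mu D u u = nrm u ^+ 2.
Proof.
by rewrite sqr_l2norm; apply: eq_Rintegral => x _; rewrite -expr2 sqr_enorm.
Qed.

Lemma L2prodv_CS u v : measurable_mx D u -> measurable_mx D v ->
  sqint mu D (fun x => enorm (u x)) -> sqint mu D (fun x => enorm (v x)) ->
  `|L2prodv mu D u v| <= nrm u * nrm v.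
Proof.
move=> mfu mv su sv; have iuv := sqint_mul mD su sv.
have ie : mu.-integrable D (EFin \o (fun x => edot (u x) (v x))).
  apply: le_integrable iuv => //; first exact/measurable_EFinP/measurable_edot.
  move=> x _ /=; rewrite lee_fin [leRHS]ger0_norm ?mulr_ge0 ?enorm_ge0//.
  exact: edot_le.
apply: le_trans (le_normr_Rintegral mD ie) _.
apply: le_trans (L2prod_CS_le mD su sv).
apply: le_Rintegral => //; first exact: integrable_norm.
by move=> x _; exact: edot_le.
Qed.

Lemma bounded_mx_sqint u B : (mu D < +oo)%E -> measurable_mx D u ->
  (forall x, D x -> forall j, `|u x ord0 j| <= B) ->
  sqint mu D (fun x => enorm (u x)).
Proof.
move=> Doo mfu uB; apply: (@bounded_sqint _ _ _ _ _ mD _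
  (enorm (const_mx B : 'rV[R]_k))) => //; first exact: measurable_enorm.
move=> x Dx; rewrite ger0_norm ?enorm_ge0//; apply: ler_enorm => i j.
by rewrite ord1 mxE uB.
Qed.

End vector_fields_L2.

(** u - u F^T F is the component of u orthogonal to the rows of F, and the
difference of the two squared norms is its squared norm. *)
Lemma enorm_mul_orthonormal (R : realType) k d (u : 'rV[R]_d) (F : 'M[R]_(k, d)) :
  F *m F^T = 1%:M -> enorm (u *m F^T) <= enorm u.
Proof.
move=> FF; rewrite ler_wsqrtr//.
have := edot_ge0 (u - u *m F^T *m F).
rewrite -[- (_ *m F)]scaleN1r !(edotDl, edotDr, edotZl, edotZr).
have uw : edot u (u *m F^T *m F) = edot (u *m F^T) (u *m F^T).
  by rewrite !edotE !trmx_mul trmxK !mulmxA.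
have ww : edot (u *m F^T *m F) (u *m F^T *m F) = edot (u *m F^T) (u *m F^T).
  by rewrite !edotE !trmx_mul trmxK !mulmxA -(mulmxA _ F F^T) FF mulmx1.
rewrite (edotC (_ *m F) u) uw ww; lra.
Qed.

(** * Discrete fields on the fractured domain *)

Section fractured_measures.
Context {R : realType} {n : nat}.
Variable G : @geometry R n.
Hypothesis hG : fractured_domain G.
Local Notation pt := 'rV[R]_n.+1.

Let surf_half := @hausdorff_halfspaces R n.+1 n.
Let leb_half := @lebesgue_halfspaces R n.

Lemma measurable_boundary i : measurable (boundary (Om G i) : set (surf_type R n)).
Proof.
by apply: closed_caratheodory => //; apply: closedI; exact: closed_closure.
Qed.

Lemma open_subdomain i : open (Om G i).
Proof. by have [_ [/(_ i)[]]] := hG. Qed.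

Lemma measurable_fracture : measurable (gam G : set (surf_type R n)).
Proof.
have [[[oO _ _ _] _] _ [_ -> _] _ _] := hG.
apply: measurableI; last exact: open_caratheodory.
by apply: measurableI; exact: measurable_boundary.
Qed.

Lemma measurable_subdomain i : measurable (Om G i : set (leb_type R n)).
Proof. by apply: open_caratheodory => //; exact: open_subdomain. Qed.

Lemma fracture_boundary i : gam G `<=` boundary (Om G i).
Proof.
have [_ _ [_ -> _] _ _] := hG.
have [->|->] : i = ord0 \/ i = ord_max.
  by case: i => -[|[|//]] ?; [left|right]; exact: val_inj.
- by move=> x [[]].
by move=> x [[]].
Qed.

Lemma fracture_domain : gam G `<=` Omega G.
Proof. by have [_ _ [-> _ _] _ _] := hG; move=> x; right. Qed.

Lemma subdomain_union i : Om G i `<=` Om G ord0 `|` Om G ord_max.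
Proof.
have [->|->] : i = ord0 \/ i = ord_max.
  by case: i => -[|[|//]] ?; [left|right]; exact: val_inj.
- by move=> x; left.
by move=> x; right.
Qed.

Lemma subdomain_domain i : Om G i `<=` Omega G.
Proof. by have [_ _ [-> _ _] _ _] := hG; move=> x /subdomain_union ?; left. Qed.

Lemma domain_coord_bounded : exists b : R,
  forall x : pt, Omega G x -> forall i, `|x ord0 i| <= b.
Proof.
have [[[_ _ _ [M [_ MO]]] _] _ _ _ _] := hG.
exists (M + 1) => x Ox i; apply: le_trans (ler_coord_norm x i) _.
by apply: MO => //; rewrite ltrDl.
Qed.

(** A bounded set is covered by one box completed by boxes reduced to a point. *)
Lemma leb_bounded (D : set pt) (b : R) :
  (forall x, D x -> forall i, `|x ord0 i| <= b) -> (leb R n D < +oo)%E.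
Proof.
move=> Db; pose c (k : nat) : pt * pt :=
  if k is 0 then (const_mx (- b), const_mx b) else (0, 0).
apply: (@le_lt_trans _ _ (\sum_(k <oo) box_vol (c k))%E).
  apply: ereal_inf_lbound; exists c => // x Dx; exists 0%N => // i /=.
  by rewrite !mxE -ler_norml Db.
rewrite (nneseries_split 0 1)//; last first.
  move=> k _; rewrite lee_fin; apply: prodr_ge0 => i _.
  by rewrite le_max lexx orbT.
rewrite eseries0 ?adde0.
  by rewrite big_nat1 ltry.
case=> // k _ _; rewrite /box_vol /c big_ord_recl /=.
by rewrite subrr maxxx mul0r.
Qed.

Lemma leb_subdomain_lty i : (leb R n (Om G i) < +oo)%E.
Proof.
have [b bO] := domain_coord_bounded; apply: (@leb_bounded _ b) => x Ox.
exact/bO/subdomain_domain/Ox.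
Qed.

Lemma measurable_normal i (D : set (surf_type R n)) : D `<=` boundary (Om G i) ->
  measurable_mx D (nrm G i : surf_type R n -> _).
Proof.
have [_ _ _ /(_ i)[_ _ mn] _] := hG.
move=> Db a j; rewrite ord1.
exact: (measurable_funS (measurable_boundary i) Db (mn j)).
Qed.

Lemma normal_unit i x : gam G x -> enorm (nrm G i x) = 1.
Proof. by have [_ _ _ /(_ i)[un _ _] _] := hG; move=> /un[]. Qed.

Lemma frame_orthonormal x : gam G x -> frame G x *m (frame G x)^T = 1%:M.
Proof. by have [_ _ _ _ [fr _]] := hG; move=> /fr[]. Qed.

Lemma measurable_frame :
  measurable_mx (gam G : set (surf_type R n)) (frame G : surf_type R n -> _).
Proof. by have [_ _ _ _ [_ mf]] := hG. Qed.

End fractured_measures.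

Section discrete_fields.
Context {R : realType} {n : nat}.
Variable G : @geometry R n.
Hypothesis hG : fractured_domain G.
Variables (Th : 'I_2 -> mesh R n.+1 n.+1) (Tg : mesh R n n.+1).
Variables (rho CQ CdTr Cinv : R).
Hypothesis hadm : admissible_meshes G Th Tg rho CQ CdTr Cinv.
Local Notation pt := 'rV[R]_n.+1.
Local Notation gm := (gam G : set (surf_type R n)).

Let surf_half := @hausdorff_halfspaces R n.+1 n.
Let leb_half := @lebesgue_halfspaces R n.

Lemma bulk_nondegenerate i j : Defs.nondegenerate (mcell (Th i) j).
Proof. by have [[/(_ i)[nd _ _ _] _] _ _ _ _] := hadm. Qed.

Lemma fracture_nondegenerate j : Defs.nondegenerate (mcell Tg j).
Proof. by have [_ _ [[nd _ _ _] _ _] _ _] := hadm. Qed.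

(** The subdomains are not empty, so their meshes have at least one element. *)
Lemma hmax_gt0 : 0 < hmax Th Tg.
Proof.
have [_ [/(_ ord0)[_ _ [x Ox]] _] _ _ _] := hG.
have [[/(_ ord0)[_ _ _ cO] _] _ _ _ _] := hadm.
have : closure (Om G ord0) x by exact: subset_closure.
rewrite cO => -[j _ _]; rewrite !lt_max (mesh_size_gt0 j)//.
exact: bulk_nondegenerate.
Qed.

Lemma RT0_pieces_affine k d (D : set 'rV[R]_d) (m : mesh R k d) (u : vfield m) :
  RT0 D u -> forall j, affine_map (u j).
Proof. by move=> [uL _] j; exact/local_RT0_affine/uL. Qed.

Lemma measurable_bulk_field i (u : vfield (Th i)) (D : set (leb_type R n)) :
  RT0 (Om G i) u -> measurable_mx D (Defs.glue u : leb_type R n -> _).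
Proof.
move=> /RT0_pieces_affine; apply: measurable_mx_glue => //.
exact: bulk_nondegenerate.
Qed.

Lemma measurable_bulk_field_surf i (u : vfield (Th i)) (D : set (surf_type R n)) :
  RT0 (Om G i) u -> measurable_mx D (Defs.glue u : surf_type R n -> _).
Proof.
move=> /RT0_pieces_affine; apply: measurable_mx_glue => //.
exact: bulk_nondegenerate.
Qed.

Lemma measurable_fracture_field (u : vfield Tg) (D : set (surf_type R n)) :
  RT0 (gam G) u -> measurable_mx D (Defs.glue u : surf_type R n -> _).
Proof.
move=> /RT0_pieces_affine; apply: measurable_mx_glue => //.
exact: fracture_nondegenerate.
Qed.

Lemma measurable_normal_trace i (u : vfield (Th i)) (D : set (surf_type R n)) :
  RT0 (Om G i) u -> D `<=` boundary (Om G i) ->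
  measurable_fun D (normal_trace G u : surf_type R n -> R).
Proof.
move=> uRT Db; apply: measurable_edot; first exact: measurable_bulk_field_surf.
exact: measurable_normal.
Qed.

Lemma measurable_tangential_div (u : vfield Tg) : RT0 (gam G) u ->
  measurable_fun gm (tangential_div (frame G) u : surf_type R n -> R).
Proof.
move=> uRT; refine (@measurable_glue _ _ _ (@hausdorff R n.+1 n) surf_half Tg
  fracture_nondegenerate gm _ _) => j.
have [c [B uE]] := RT0_pieces_affine uRT j.
have -> : (fun x : surf_type R n => \tr (frame G x *m jacobian (u j) x *m (frame G x)^T))
    = fun x => \tr (frame G x *m B *m (frame G x)^T).
  by apply/funext => x; rewrite (jacobian_affine _ uE).
have mf := measurable_frame hG.
apply: measurable_trace; apply: measurable_mx_mul; last exact: measurable_mx_tr.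
exact: (measurable_mx_mul mf (@measurable_mx_cst _ (surf_type R n) _ _ _ _ B)).
Qed.

(** Piecewise affine fields are bounded on the bounded domain, which has finite
volume. *)
Lemma sqint_bulk_field i (u : vfield (Th i)) : RT0 (Om G i) u ->
  sqint (leb R n) (Om G i) (fun x => enorm (Defs.glue u x)).
Proof.
move=> uRT; have [b bO] := domain_coord_bounded hG.
have [B uB] := bounded_glue b (RT0_pieces_affine uRT).
apply: (@bounded_mx_sqint _ _ _ _ _ _ _ _ B).
- exact: measurable_subdomain.
- exact: leb_subdomain_lty.
- exact: measurable_bulk_field.
move=> x Ox; apply: uB => i'; exact/bO/(subdomain_domain hG)/Ox.
Qed.

Lemma sqint_normal_trace i (u : vfield (Th i)) : (surf R n (gam G) < +oo)%E ->
  RT0 (Om G i) u -> sqint (surf R n) (gam G) (normal_trace G u).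
Proof.
move=> goo uRT; have [b bO] := domain_coord_bounded hG.
have [B uB] := bounded_glue b (RT0_pieces_affine uRT).
apply: (@bounded_sqint _ _ _ _ _ (measurable_fracture hG) _
  (enorm (const_mx B : pt))) => //.
  exact/measurable_normal_trace/fracture_boundary.
move=> x gx; rewrite (le_trans (edot_le _ _))// (normal_unit hG)// mulr1.
apply: ler_enorm => a j; rewrite ord1 mxE; apply: uB => i'.
exact/bO/(fracture_domain hG)/gx.
Qed.

(** The discrete trace inequality is stated on the whole boundary and between
norms that may be infinite; here it is restricted to the fracture and squared,
with finite norms. *)
Lemma trace_inequality i (u : vfield (Th i)) : (surf R n (gam G) < +oo)%E ->
  0 < CdTr -> RT0 (Om G i) u ->
  l2norm (surf R n) (gam G) (normal_trace G u) ^+ 2 <=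
  CdTr ^+ 2 * (hmax Th Tg)^-1 *
    l2norm (leb R n) (Om G i) (fun x => enorm (Defs.glue u x)) ^+ 2.
Proof.
move=> goo C0 uRT; have [_ _ _ _ [/(_ i u uRT) tr _]] := hadm.
have h0 := hmax_gt0.
have su := sqint_bulk_field uRT; have st := sqint_normal_trace goo uRT.
have {}tr : l2norm (surf R n) (gam G) (normal_trace G u) <=
    CdTr * hmax Th Tg `^ (- 2^-1) *
    l2norm (leb R n) (Om G i) (fun x => enorm (Defs.glue u x)).
  rewrite -lee_fin EFinM.
  rewrite -!L2normE//; try exact: measurable_fracture; try exact: measurable_subdomain.
  apply: le_trans tr; rewrite /L2norm.
  have intge0 D : (0 <= \int[surf R n]_(x in D) (normal_trace G u x ^+ 2)%:E)%E.
    by apply: integral_ge0 => x _; rewrite lee_fin sqr_ge0.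
  have mtr : measurable_fun (boundary (Om G i) : set (surf_type R n))
      (fun x : surf_type R n => (normal_trace G u x ^+ 2)%:E).
    by apply/measurable_EFinP/measurable_funX/measurable_normal_trace.
  have mono : (\int[surf R n]_(x in gam G) (normal_trace G u x ^+ 2)%:E <=
      \int[surf R n]_(x in boundary (Om G i)) (normal_trace G u x ^+ 2)%:E)%E.
    apply: (@ge0_subset_integral _ _ _ _ _ _ (measurable_fracture hG)
      (measurable_boundary G i) _ mtr _ (@fracture_boundary _ _ _ hG i)) => x _.
    by rewrite lee_fin sqr_ge0.
  by apply: gt0_ler_poweR => //; rewrite ?invr_ge0// in_itv/= leey andbT intge0.
have hE : (hmax Th Tg)^-1 = (hmax Th Tg `^ (- 2^-1)) ^+ 2.
  by rewrite powRN powR12_sqrt ?(ltW h0)// exprVn sqr_sqrtr// ltW.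
rewrite hE -!exprMn lerXn2r ?nnegrE ?l2norm_ge0//.
by rewrite !mulr_ge0 ?l2norm_ge0 ?powR_ge0// ltW.
Qed.

Lemma inverse_inequality (u : vfield Tg) : RT0 (gam G) u ->
  sqint (surf R n) (gam G) (fun x => enorm (Defs.glue u x)) ->
  sqint (surf R n) (gam G) (tangential_div (frame G) u) /\
  l2norm (surf R n) (gam G) (tangential_div (frame G) u) <=
  Cinv * (hmax Th Tg)^-1 *
    l2norm (surf R n) (gam G) (fun x => enorm (Defs.glue u x)).
Proof.
move=> uRT su; have [_ _ _ _ [_ /(_ u uRT)inv]] := hadm.
have mg := measurable_fracture hG.
have mdiv := measurable_tangential_div uRT.
rewrite /L2normv [X in (_ <= _ * X)%E](L2normE mg su) -EFinM in inv.
have sdiv : sqint (surf R n) (gam G) (tangential_div (frame G) u).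
  by apply: (L2norm_lty_sqint mdiv); rewrite (le_lt_trans inv)// ltry.
by split=> //; rewrite L2normE// lee_fin in inv.
Qed.

End discrete_fields.

(** * Fracture form and interface form *)

Lemma tensor_boundsS d (T : measurableType d) (R : realType)
    (mu : {measure set T -> \bar R}) (D E : set T) k (M : T -> 'M[R]_k) c C :
  measurable E -> D `<=` E -> tensor_bounds mu E M c C -> tensor_bounds mu D M c C.
Proof.
move=> mE DE [mM hM]; split=> [i j|]; first exact: measurable_funS (mM i j).
by apply: filterS hM => x + /DE; apply.
Qed.

Section fracture_forms.
Context {R : realType} {n : nat}.
Variable G : @geometry R n.
Hypothesis hG : fractured_domain G.
Variables (Th : 'I_2 -> mesh R n.+1 n.+1) (Tg : mesh R n n.+1).
Variables (rho CQ CdTr Cinv : R).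
Hypothesis hadm : admissible_meshes G Th Tg rho CQ CdTr Cinv.
Variables (Kg : 'rV[R]_n.+1 -> 'M[R]_n) (cKg CKg : R).
Hypothesis hKg : tensor_bounds (surf R n) (gam G) Kg cKg CKg.
Hypothesis cKg0 : 0 < cKg.
Variables (Lg tau : R).
Hypotheses (Lg0 : 0 < Lg) (tau0 : 0 < tau).
Local Notation S := (surf R n).
Local Notation gm := (gam G : set (surf_type R n)).
Local Notation unrm u := (l2norm S (gam G) (fun x => enorm (Defs.glue u x))).
Local Notation lnrm q := (l2norm S (gam G) (Defs.sval q)).
Implicit Types (u v : vfield Tg) (q : sfield Tg) (y : vfield Tg * sfield Tg).

Definition star_sq y : R :=
  a_gamma G Kg y.1 y.1 + Lg * unrm y.1 ^+ 2 + tau^-1 * lnrm y.2 ^+ 2.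

Definition finite_star y := [/\ RT0 (gam G) y.1,
  sqint S (gam G) (fun z => enorm (Defs.glue y.1 z)) &
  sqint S (gam G) (Defs.sval y.2)].

Let mg := measurable_fracture hG.

Let tangent u : surf_type R n -> 'rV[R]_n :=
  fun z => Defs.glue u z *m (frame G z)^T.

Let measurable_tangent u : RT0 (gam G) u -> measurable_mx gm (tangent u).
Proof.
move=> uRT.
exact: (measurable_mx_mul (measurable_fracture_field hadm (D := gm) uRT)
  (measurable_mx_tr (measurable_frame hG))).
Qed.

Let tangent_le u z : gam G z -> enorm (tangent u z) <= enorm (Defs.glue u z).
Proof. by move=> gz; apply/enorm_mul_orthonormal/frame_orthonormal. Qed.

Let sqint_tangent u : RT0 (gam G) u ->
  sqint S (gam G) (fun z => enorm (Defs.glue u z)) ->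
  sqint S (gam G) (fun z => enorm (tangent u z)).
Proof.
move=> uRT [mfu iu]; have mt := measurable_enorm (measurable_tangent uRT).
split=> //; apply: le_integrable iu => //.
  exact/measurable_EFinP/measurable_funX.
move=> z gz /=; rewrite lee_fin !ger0_norm ?sqr_ge0//.
by rewrite lerXn2r ?nnegrE ?enorm_ge0// tangent_le.
Qed.

Let tangent_l2norm_le u : RT0 (gam G) u ->
  sqint S (gam G) (fun z => enorm (Defs.glue u z)) ->
  l2norm S (gam G) (fun z => enorm (tangent u z)) <= unrm u.
Proof.
move=> uRT su; have st := sqint_tangent uRT su.
rewrite ler_wsqrtr//; apply: le_Rintegral => //; try exact: sqint_mul.
by move=> z gz; rewrite ler_pM ?enorm_ge0// tangent_le.
Qed.

Lemma a_gamma_ge0 u : RT0 (gam G) u ->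
  sqint S (gam G) (fun z => enorm (Defs.glue u z)) -> 0 <= a_gamma G Kg u u.
Proof.
move=> uRT su; apply: le_trans (inv_form_lower mg hKg (measurable_tangent uRT)
  (sqint_tangent uRT su)).
by rewrite mulr_ge0 ?sqr_ge0// ltW.
Qed.

(** The norm is the square root of a sum of three integrals in the extended
reals. They are nonnegative, so if the norm is finite each of them is, and the
discrete functions are square integrable: this is where the integrability of
fields on the fracture comes from. *)
Lemma star_norm_finite y : RT0 (gam G) y.1 ->
  (star_norm G Kg Lg tau y < +oo)%E ->
  finite_star y /\ star_norm G Kg Lg tau y = (Num.sqrt (star_sq y))%:E.
Proof.
case: y => u q /= uRT fin.
have mfu := measurable_fracture_field hadm (D := gm) uRT.
have mt := measurable_tangent uRT.
have mq : measurable_fun gm (Defs.sval q : surf_type R n -> R).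
  exact: (measurable_sval (@hausdorff_halfspaces R n.+1 n)
    (fracture_nondegenerate hadm)).
have half0 : 2^-1 != 0 :> R by rewrite invr_eq0 pnatr_eq0.
have sL0 : Num.sqrt Lg != 0 by rewrite sqrtr_eq0 -ltNge.
have t0 : tau `^ (- 2^-1) != 0 by rewrite gt_eqF// powR_gt0.
move: fin; rewrite /star_norm /=.
set T1 := (\int[_]_(x in _) _)%E; set T2 := L2normv _ _ _; set T3 := L2norm _ _ _.
have T10 : (0 <= T1)%E by exact: (integral_inv_form_ge0 mg hKg (ltW cKg0) mt).
have T20 : (0 <= T2)%E by exact: poweR_ge0.
have T30 : (0 <= T3)%E by exact: poweR_ge0.
have T2s : (0 <= T2 * T2)%E by exact: mule_ge0.
have T3s : (0 <= T3 * T3)%E by exact: mule_ge0.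
move=> /lty_poweRy sum_lty; have {}sum_lty := sum_lty half0.
have T2oo : (T2 < +oo)%E.
  rewrite ltey; apply/eqP => T2E; move: sum_lty; rewrite T2E mulyy.
  by rewrite addey ?addye ?ltxx// -?ltNye ?(lt_le_trans _ T10)// (lt_le_trans _ T3s).
have T3oo : (T3 < +oo)%E.
  rewrite ltey; apply/eqP => T3E; move: sum_lty; rewrite T3E mulyy.
  by rewrite addey ?ltxx// -ltNye (lt_le_trans _ (adde_ge0 T10 T2s)).
have mwu : measurable_fun gm
    (fun x : surf_type R n => enorm (Num.sqrt Lg *: Defs.glue u x)).
  apply: measurable_enorm => i j; under eq_fun do rewrite mxE.
  by apply: measurable_funM; [exact: measurable_cst|exact: mfu].
have mwq : measurable_fun gm
    (fun x : surf_type R n => tau `^ (- 2^-1) * Defs.sval q x).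
  by apply: measurable_funM; [exact: measurable_cst|exact: mq].
have swu := L2norm_lty_sqint mwu T2oo.
have swq := L2norm_lty_sqint mwq T3oo.
have su : sqint S (gam G) (fun x => enorm (Defs.glue u x)).
  rewrite (_ : (fun x => _) = fun x => (Num.sqrt Lg)^-1 *
      enorm (Num.sqrt Lg *: Defs.glue u x)); first exact: sqintZ.
  apply/funext => x; rewrite enormZ ger0_norm ?sqrtr_ge0//.
  by rewrite mulrA mulVf// mul1r.
have sq : sqint S (gam G) (Defs.sval q).
  rewrite (_ : Defs.sval q = fun x => (tau `^ (- 2^-1))^-1 *
      (tau `^ (- 2^-1) * Defs.sval q x)); first exact: sqintZ.
  by apply/funext => x; rewrite mulrA mulVf// mul1r.
split=> //.
have T1E : T1 = (a_gamma G Kg u u)%:E.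
  have st := sqint_tangent uRT su.
  rewrite -[LHS]fineK//.
  exact: integrable_fin_num (integrable_inv_form mg hKg mt mt st st).
have T2E : (T2 * T2)%E = (Lg * unrm u ^+ 2)%:E.
  rewrite /T2 /L2normv L2normE// -EFinM -expr2 !sqr_l2norm; congr _%:E.
  rewrite -RintegralZl//; last exact: sqint_mul.
  apply: eq_Rintegral => x _; rewrite enormZ ger0_norm ?sqrtr_ge0//.
  by rewrite mulrACA -expr2 sqr_sqrtr// ltW.
have T3E : (T3 * T3)%E = (tau^-1 * lnrm q ^+ 2)%:E.
  rewrite /T3 L2normE// -EFinM -expr2 !sqr_l2norm; congr _%:E.
  rewrite -RintegralZl//; last exact: sqint_mul.
  apply: eq_Rintegral => x _; rewrite mulrACA -powRD; last first.
    by rewrite (gt_eqF tau0) implybT.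
  have -> : - 2^-1 + - 2^-1 = -1 :> R by lra.
  by rewrite powR_inv1// ltW.
rewrite T1E T2E T3E -!EFinD poweR_EFin powR12_sqrt//.
by rewrite !addr_ge0 ?a_gamma_ge0// mulr_ge0 ?sqr_ge0 ?invr_ge0// ltW.
Qed.

Lemma star_sq_ge y : finite_star y ->
  [/\ 0 <= star_sq y, Lg * unrm y.1 ^+ 2 <= star_sq y &
      tau^-1 * lnrm y.2 ^+ 2 <= star_sq y].
Proof.
move=> [uRT su sq]; rewrite /star_sq; have := a_gamma_ge0 uRT su.
have : 0 <= Lg * unrm y.1 ^+ 2 by rewrite mulr_ge0 ?sqr_ge0// ltW.
have : 0 <= tau^-1 * lnrm y.2 ^+ 2 by rewrite mulr_ge0 ?sqr_ge0 ?invr_ge0// ltW.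
by move=> ? ? ?; split; lra.
Qed.

(** The divergence terms b(u, mu) and - b(v, lambda) cancel on the diagonal,
which makes the form coercive with constant one for the norm of the unknowns. *)
Lemma A_gamma_diag y : A_gamma G Kg Lg tau y y = star_sq y.
Proof. by rewrite /A_gamma /star_sq L2prodv_sqr -sqr_l2norm -addrA subrr addr0. Qed.

(** The divergence is controlled by the inverse inequality, which costs a factor
1 / h. *)
Lemma A_gamma_bound (x y : vfield Tg * sfield Tg) : finite_star x -> finite_star y ->
  `|A_gamma G Kg Lg tau x y| <=
  (`|CKg| + Lg) * (unrm x.1 * unrm y.1) + tau^-1 * (lnrm x.2 * lnrm y.2) +
  Cinv * (hmax Th Tg)^-1 * (unrm x.1 * lnrm y.2 + unrm y.1 * lnrm x.2).
Proof.
move=> [xRT sx sqx] [yRT sy sqy].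
have Ha : `|a_gamma G Kg x.1 y.1| <= `|CKg| * (unrm x.1 * unrm y.1).
  apply: le_trans (inv_form_upper mg hKg (measurable_tangent xRT)
    (measurable_tangent yRT) (sqint_tangent xRT sx) (sqint_tangent yRT sy)) _.
  by rewrite ler_wpM2l// ler_pM ?l2norm_ge0// tangent_l2norm_le.
have HL : `|Lg * L2prodv S (gam G) (Defs.glue x.1) (Defs.glue y.1)| <=
    Lg * (unrm x.1 * unrm y.1).
  rewrite normrM (ger0_norm (ltW Lg0)) ler_wpM2l ?(ltW Lg0)//.
  exact: (L2prodv_CS mg (measurable_fracture_field hadm (D := gm) xRT)
    (measurable_fracture_field hadm (D := gm) yRT) sx sy).
have Ht : `|tau^-1 * L2prod S (gam G) (Defs.sval x.2) (Defs.sval y.2)| <=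
    tau^-1 * (lnrm x.2 * lnrm y.2).
  rewrite normrM ger0_norm ?invr_ge0 ?(ltW tau0)// ler_wpM2l ?invr_ge0 ?(ltW tau0)//.
  exact: (L2prod_CS mg sqx sqy).
have Hb u q : RT0 (gam G) u -> sqint S (gam G) (fun z => enorm (Defs.glue u z)) ->
    sqint S (gam G) (Defs.sval q) ->
    `|b_gamma G u q| <= Cinv * (hmax Th Tg)^-1 * (unrm u * lnrm q).
  move=> uRT su sq; have [sdiv ndiv] := inverse_inequality hG hadm uRT su.
  apply: le_trans (L2prod_CS mg sdiv sq) _.
  by rewrite mulrA ler_wpM2r ?l2norm_ge0.
have Hb1 := Hb _ _ xRT sx sqy; have Hb2 := Hb _ _ yRT sy sqx.
rewrite /A_gamma; move: Ha HL Ht Hb1 Hb2.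
set a := a_gamma _ _ _ _; set b1 := b_gamma _ _ _; set b2 := b_gamma _ y.1 _.
set L := Lg * L2prodv _ _ _ _; set t := tau^-1 * L2prod _ _ _ _.
move=> Ha HL Ht Hb1 Hb2.
apply: le_trans (ler_normB _ _) _; apply: le_trans (lerD (ler_normD _ _) (lexx _)) _.
apply: le_trans (lerD (lerD (ler_normD _ _) (lexx _)) (lexx _)) _.
apply: le_trans (lerD (lerD (lerD (ler_normD _ _) (lexx _)) (lexx _)) (lexx _)) _.
apply: le_trans (lerD (lerD (lerD (lerD Ha HL) Ht) Hb1) Hb2) _.
by rewrite mulrDl [_ * (_ + _)]mulrDr !addrA.
Qed.

End fracture_forms.

Section interface_form.
Context {R : realType} {n : nat}.
Variable G : @geometry R n.
Hypothesis hG : fractured_domain G.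
Variables (Th : 'I_2 -> mesh R n.+1 n.+1) (Tg : mesh R n n.+1).
Variables (rho CQ CdTr Cinv : R).
Hypothesis hadm : admissible_meshes G Th Tg rho CQ CdTr Cinv.
Variables (K : 'rV[R]_n.+1 -> 'M[R]_n.+1) (cK CK : R).
Hypothesis cK0 : 0 < cK.
Hypothesis hK : tensor_bounds (leb R n) (Om G ord0 `|` Om G ord_max) K cK CK.
Hypothesis gam_lty : (surf R n (gam G) < +oo)%E.
Variables (ralpha tau : R).
Hypotheses (ralpha0 : 0 <= ralpha) (tau0 : 0 < tau).
Local Notation S := (surf R n).
Local Notation tnrm u := (l2norm S (gam G) (normal_trace G u)).
Local Notation lnrm q := (l2norm S (gam G) (Defs.sval q)).

Let mg := measurable_fracture hG.

Lemma a_bulk_lower i (u : vfield (Th i)) : RT0 (Om G i) u ->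
  cK * l2norm (leb R n) (Om G i) (fun x => enorm (Defs.glue u x)) ^+ 2 +
  ralpha * tnrm u ^+ 2 <= a_bulk G K ralpha u u.
Proof.
move=> uRT; rewrite /a_bulk -[L2prod S _ _ _]sqr_l2norm lerD2r.
have mOm := measurable_subdomain hG.
have hKi : tensor_bounds (leb R n) (Om G i) K cK CK.
  apply: tensor_boundsS hK; last exact: subdomain_union.
  by apply: measurableU; exact: mOm.
exact: (inv_form_lower (mOm i) hKi (measurable_bulk_field hadm (D := Om G i) uRT)
  (sqint_bulk_field hG hadm uRT)).
Qed.

Lemma a_bulk_ge0 i (u : vfield (Th i)) : RT0 (Om G i) u ->
  0 <= a_bulk G K ralpha u u.
Proof.
move=> /a_bulk_lower; apply: le_trans.
by rewrite addr_ge0// mulr_ge0 ?sqr_ge0// ltW.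
Qed.

(** Testing the local problem with its own solution, the pressure contributes
the nonnegative term |p|^2 / tau. *)
Lemma local_energy i (lambda : sfield Tg) (u : vfield (Th i)) (p : sfield (Th i)) :
  local_solution G K ralpha tau lambda u p ->
  a_bulk G K ralpha u u <=
  - L2prod S (gam G) (Defs.sval lambda) (normal_trace G u).
Proof.
move=> [uRT /(_ u uRT) <- /(_ p) cp].
rewrite lerDl oppr_ge0 -(pmulr_rle0 _ tau0).
have : 0 <= c_bulk G p p by exact: L2prod_ge0.
lra.
Qed.

(** With a finite Robin parameter alpha, the boundary term of the local energy
gives beta = alpha; for a continuous pressure that term disappears, and beta
comes from the discrete trace inequality and the ellipticity of K^-1. *)
Variable beta : R.
Hypothesis beta0 : 0 < beta.
Hypothesis trace_energy : forall i (u : vfield (Th i)), RT0 (Om G i) u ->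
  tnrm u ^+ 2 <= beta * a_bulk G K ralpha u u.

(** The energy is bounded by the product of the norms of lambda and of the
normal trace, and it controls the square of the normal trace: one factor
cancels. *)
Lemma local_trace_bound i (lambda : sfield Tg) (u : vfield (Th i)) (p : sfield (Th i)) :
  local_solution G K ralpha tau lambda u p ->
  sqint S (gam G) (Defs.sval lambda) -> tnrm u <= beta * lnrm lambda.
Proof.
move=> sol sl; have [uRT _ _] := sol.
have [->|t0] := eqVneq (tnrm u) 0; first by rewrite mulr_ge0 ?l2norm_ge0// ltW.
have {}t0 : 0 < tnrm u by rewrite lt_neqAle eq_sym t0 l2norm_ge0.
rewrite -(ler_pM2r t0) -expr2 (le_trans (trace_energy uRT))//.
rewrite -mulrA ler_wpM2l ?(ltW beta0)// (le_trans (local_energy sol))//.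
apply: le_trans (ler_norm _) _; rewrite normrN.
exact: (L2prod_CS mg sl (sqint_normal_trace hG hadm gam_lty uRT)).
Qed.

Variables (us : forall i, sfield Tg -> vfield (Th i))
  (ps : forall i, sfield Tg -> sfield (Th i)).
Hypothesis sol : forall i lambda,
  local_solution G K ralpha tau lambda (@us i lambda) (@ps i lambda).

(** By the energy estimate each of the two contributions is at least the energy
of the local solution. *)
Lemma s_gamma_ge0 lambda : 0 <= s_gamma G (@us) lambda lambda.
Proof.
rewrite /s_gamma -sumrN sumr_ge0// => i _; rewrite L2prodC.
apply: le_trans (local_energy (sol i lambda)).
by have [uRT _ _] := sol i lambda; exact: a_bulk_ge0.
Qed.

Lemma s_gamma_bound lambda mu : sqint S (gam G) (Defs.sval lambda) ->
  sqint S (gam G) (Defs.sval mu) ->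
  `|s_gamma G (@us) lambda mu| <= 2 * beta * (lnrm lambda * lnrm mu).
Proof.
move=> sl sm.
have term i : `|L2prod S (gam G) (normal_trace G (@us i lambda)) (Defs.sval mu)| <=
    beta * (lnrm lambda * lnrm mu).
  have [uRT _ _] := sol i lambda.
  apply: le_trans (L2prod_CS mg (sqint_normal_trace hG hadm gam_lty uRT) sm) _.
  rewrite mulrA ler_wpM2r ?l2norm_ge0//; exact: local_trace_bound (sol i lambda) sl.
rewrite /s_gamma normrN big_ord_recl big_ord1.
apply: le_trans (ler_normD _ _) _.
by rewrite -mulrA mulr_natl mulr2n lerD.
Qed.

End interface_form.

(** * The domain decomposition matrix *)

(** Here a = L^(1/2) and t = tau^(1/2); s and w stand for the norms of the two
arguments, which control a u and l / t. *)
Lemma scaled_form_bound (R : realFieldType)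
    (C c b a t uV uW lV lW s w : R) :
  0 <= C -> 0 <= c -> 0 <= b -> 0 < a -> 0 < t ->
  0 <= uV -> 0 <= uW -> 0 <= lV -> 0 <= lW ->
  uV <= s / a -> uW <= w / a -> lV <= t * s -> lW <= t * w ->
  (C + a ^+ 2) * (uV * uW) + (t ^+ 2)^-1 * (lV * lW) +
    c * (uV * lW + uW * lV) + 2 * b * (lV * lW) <=
  (C / a ^+ 2 + 2 + 2 * (c * t / a) + 2 * (b * t ^+ 2)) * (s * w).
Proof.
move=> C0 c0 b0 a0 t0 uV0 uW0 lV0 lW0 uVs uWw lVs lWw.
have uu : uV * uW <= (s / a) * (w / a) by exact: ler_pM.
have ll : lV * lW <= (t * s) * (t * w) by exact: ler_pM.
have ul : uV * lW + uW * lV <= (s / a) * (t * w) + (w / a) * (t * s).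
  by rewrite lerD// ler_pM.
apply: (@le_trans _ _ ((C + a ^+ 2) * ((s / a) * (w / a)) +
    (t ^+ 2)^-1 * ((t * s) * (t * w)) +
    c * ((s / a) * (t * w) + (w / a) * (t * s)) + 2 * b * ((t * s) * (t * w)))).
  rewrite !lerD// ler_wpM2l// ?invr_ge0 ?sqr_ge0 ?addr_ge0 ?sqr_ge0//.
  by rewrite mulr_ge0.
rewrite le_eqVlt; apply/orP; left; apply/eqP; field.
by rewrite (gt_eqF a0) (gt_eqF t0).
Qed.

Section domain_decomposition_matrix.
Context {R : realType} {n : nat}.
Variable G : @geometry R n.
Hypothesis hG : fractured_domain G.
Variables (Th : 'I_2 -> mesh R n.+1 n.+1) (Tg : mesh R n n.+1).
Variables (rho CQ CdTr Cinv : R).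
Hypothesis hadm : admissible_meshes G Th Tg rho CQ CdTr Cinv.
Hypothesis Cinv0 : 0 < Cinv.
Variables (Kg : 'rV[R]_n.+1 -> 'M[R]_n) (cKg CKg : R).
Hypothesis hKg : tensor_bounds (surf R n) (gam G) Kg cKg CKg.
Hypothesis cKg0 : 0 < cKg.
Variables (Lg tau : R).
Hypotheses (Lg0 : 0 < Lg) (tau0 : 0 < tau).
Variables (N : nat) (e : 'I_N -> vfield Tg * sfield Tg) (cmu Cmu : R).
Hypothesis cmu0 : 0 < cmu.
Hypothesis basis_e : is_basis G e.
Hypothesis equiv_e : norm_equivalence G Th e Kg Lg tau cmu Cmu.
Local Notation S := (surf R n).

Lemma RT0_basis_combination (V : 'cV[R]_N) : RT0 (gam G) (combination e V).1.
Proof. by apply: (@RT0_combination _ _ _ _ _ N (fun i => V i 0)); exact: basis_e.1. Qed.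

(** The assumed equivalence with the Euclidean norm bounds the norm of every
discrete function, which is therefore finite. *)
Lemma finite_star_combination (V : 'cV[R]_N) :
  finite_star G (combination e V) /\
  star_norm G Kg Lg tau (combination e V) =
    (Num.sqrt (star_sq G Kg Lg tau (combination e V)))%:E.
Proof.
apply: (star_norm_finite hG hadm hKg cKg0 Lg0 tau0); first exact: RT0_basis_combination.
by have /andP[_ /le_lt_trans] := equiv_e V; apply; rewrite ltry.
Qed.

(** The discrete function (0, 1) has a finite norm, and the square of its norm
is the area of the fracture divided by the time step. *)
Lemma fracture_area_lty : (S (gam G) < +oo)%E.
Proof.
have mg := measurable_fracture hG.
pose zero : vfield Tg := fun j x => \sum_(i < 0) (0 : R) *: (0 : 'rV[R]_n.+1).
have zeroRT : RT0 (gam G) zero.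
  by apply: (@RT0_combination _ _ _ _ Tg 0 (fun=> 0) (fun _ _ _ => 0)); case.
have [V [VE _]] := basis_e.2 zero (fun=> 1) zeroRT.
have [[_ _ +] _] := finite_star_combination V; rewrite VE => -[_].
move=> /integrableP[_]; rewrite (eq_integral (cst 1%:E)).
  by rewrite integral_cst// mul1e.
move=> x /set_mem gx /=; rewrite sval1 ?expr1n ?normr1//.
have [_ _ [[_ _ _ <-] _ _] _ _] := hadm; exact: subset_closure.
Qed.

Variables (K : 'rV[R]_n.+1 -> 'M[R]_n.+1) (cK CK : R).
Hypothesis cK0 : 0 < cK.
Hypothesis hK : tensor_bounds (leb R n) (Om G ord0 `|` Om G ord_max) K cK CK.
Variables (ralpha beta : R).
Hypotheses (ralpha0 : 0 <= ralpha) (beta0 : 0 < beta).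
Hypothesis trace_energy : forall i (u : vfield (Th i)), RT0 (Om G i) u ->
  l2norm S (gam G) (normal_trace G u) ^+ 2 <= beta * a_bulk G K ralpha u u.
Variable A : 'M[R]_N.
Hypothesis DD_A : is_DD_matrix G Th e K Kg Lg ralpha tau A.
Local Notation h := (hmax Th Tg).

Definition continuity_constant : R :=
  `|CKg| / Lg + 2 + 2 * (Cinv * h^-1 * Num.sqrt tau / Num.sqrt Lg)
  + 2 * (beta * tau).

Local Notation star V := (Num.sqrt (star_sq G Kg Lg tau (combination e V))).

Lemma DD_matrix_coercive V : star V ^+ 2 <= edot (A *m V) V.
Proof.
have [us [ps [sol ->]]] := DD_A; have [finV _] := finite_star_combination V.
have [star0 _ _] := star_sq_ge hG hadm hKg cKg0 Lg0 tau0 finV.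
rewrite sqr_sqrtr// A_gamma_diag lerDl.
exact: (s_gamma_ge0 hG hadm cK0 hK ralpha0 tau0 sol).
Qed.

Lemma DD_matrix_bounded V W :
  `|edot (A *m V) W| <= continuity_constant * (star V * star W).
Proof.
have [us [ps [sol ->]]] := DD_A.
have [finV _] := finite_star_combination V.
have [finW _] := finite_star_combination W.
have Ab := A_gamma_bound hG hadm hKg Lg0 tau0 finV finW.
have [_ _ qV] := finV; have [_ _ qW] := finW.
have sb := s_gamma_bound hG hadm fracture_area_lty tau0 beta0 trace_energy sol qV qW.
apply: le_trans (ler_normD _ _) _; apply: le_trans (lerD Ab sb) _ => {Ab sb}.
have a0 : 0 < Num.sqrt Lg by rewrite sqrtr_gt0.
have t0 : 0 < Num.sqrt tau by rewrite sqrtr_gt0.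
have scaled (y : vfield Tg * sfield Tg) : finite_star G y ->
    l2norm S (gam G) (fun x => enorm (Defs.glue y.1 x)) <=
      Num.sqrt (star_sq G Kg Lg tau y) / Num.sqrt Lg /\
    l2norm S (gam G) (Defs.sval y.2) <=
      Num.sqrt tau * Num.sqrt (star_sq G Kg Lg tau y).
  move=> finy; have [s0 su sl] := star_sq_ge hG hadm hKg cKg0 Lg0 tau0 finy.
  split.
    rewrite ler_pdivlMr// -(ger0_norm (l2norm_ge0 _ _ _)) -sqrtr_sqr.
    by rewrite -sqrtrM ?sqr_ge0// ler_wsqrtr// mulrC.
  rewrite -(ger0_norm (l2norm_ge0 _ _ _)) -sqrtr_sqr -sqrtrM ?(ltW tau0)//.
  by rewrite ler_wsqrtr// -ler_pdivrMl.
have [uV lV] := scaled _ finV; have [uW lW] := scaled _ finW.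
rewrite /continuity_constant.
have LE : Lg = Num.sqrt Lg ^+ 2 by rewrite sqr_sqrtr// ltW.
have tE : tau = Num.sqrt tau ^+ 2 by rewrite sqr_sqrtr// ltW.
have c0 : 0 <= Cinv * h^-1 by rewrite mulr_ge0 ?invr_ge0// ltW// (hmax_gt0 hG hadm).
have := scaled_form_bound (normr_ge0 CKg) c0 (ltW beta0) a0 t0
  (l2norm_ge0 _ _ _) (l2norm_ge0 _ _ _) (l2norm_ge0 _ _ _) (l2norm_ge0 _ _ _)
  uV uW lV lW.
by rewrite -LE -tE.
Qed.

(** The powers of h in the equivalence of norms are the same in both bounds and
cancel in the condition number. *)
Lemma DD_matrix_cond :
  A \in unitmx /\ cond A <= (Cmu / cmu) ^+ 2 * continuity_constant.
Proof.
set H := h `^ (n.+1%:R / 2).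
have H0 : 0 < H by rewrite powR_gt0// (hmax_gt0 hG hadm).
have lower V : cmu * H * enorm V <= star V.
  by rewrite -lee_fin -(finite_star_combination V).2; have /andP[] := equiv_e V.
have upper V : star V <= Cmu * H * enorm V.
  by rewrite -lee_fin -(finite_star_combination V).2; have /andP[] := equiv_e V.
have M0 : 0 <= continuity_constant.
  rewrite !addr_ge0 ?mulr_ge0 ?invr_ge0 ?sqrtr_ge0//; try exact: ltW.
  by rewrite ltW// (hmax_gt0 hG hadm).
have cH0 : 0 < (cmu * H) ^+ 2 by rewrite exprn_gt0// mulr_gt0.
have [|V|V W|Au condA] :=
    @coercive_cond _ _ A _ (continuity_constant * (Cmu * H) ^+ 2) cH0.
- by rewrite mulr_ge0// sqr_ge0.
- apply: le_trans (DD_matrix_coercive V); rewrite -exprMn.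
  by rewrite lerXn2r ?nnegrE ?sqrtr_ge0// !mulr_ge0 ?enorm_ge0// ltW.
- apply: le_trans (DD_matrix_bounded V W) _; rewrite -mulrA ler_wpM2l//.
  by rewrite expr2 mulrACA ler_pM ?sqrtr_ge0.
split=> //; apply: le_trans condA _; rewrite le_eqVlt; apply/orP; left; apply/eqP.
by field; rewrite (gt_eqF H0) (gt_eqF cmu0).
Qed.

(** The mixed term Cinv tau^(1/2) / h is not of the form claimed; it is
absorbed by s <= 1 + s^2 with s = tau^(1/2) / h. *)
Lemma continuity_constant_le : continuity_constant <=
  (`|CKg| / Lg + 4 + 2 * ((Cinv + cKg^-1) / Num.sqrt Lg)) *
  Num.max (1 + Cinv * cKg * tau * h ^- 2) (1 + beta * tau).
Proof.
have h0 := hmax_gt0 hG hadm.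
set X := Num.max _ _.
have X1 : 1 + Cinv * cKg * tau * h ^- 2 <= X by rewrite le_max lexx.
have X2 : 1 + beta * tau <= X by rewrite le_max lexx orbT.
have Xge1 : 1 <= X.
  by apply: le_trans X2; rewrite lerDl ltW// mulr_gt0.
have a0 : 0 < Num.sqrt Lg by rewrite sqrtr_gt0.
set s := Num.sqrt tau / h.
have sE : s ^+ 2 = tau * h ^- 2 by rewrite exprMn exprVn sqr_sqrtr// ltW.
have CcK0 : 0 <= Cinv + cKg^-1 by rewrite addr_ge0 ?invr_ge0// ltW.
have mixed : Cinv * s <= (Cinv + cKg^-1) * X.
  have s1 : s <= 1 + s ^+ 2 by have := sqr_ge0 (s - 1); nra.
  apply: (@le_trans _ _ ((Cinv + cKg^-1) * (1 + Cinv * cKg * s ^+ 2))); last first.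
    by rewrite ler_wpM2l// sE mulrA.
  have -> : (Cinv + cKg^-1) * (1 + Cinv * cKg * s ^+ 2) =
      Cinv * (1 + s ^+ 2) + (cKg^-1 + Cinv * Cinv * cKg * s ^+ 2).
    by field; rewrite gt_eqF.
  rewrite -[leLHS]addr0 lerD//; first by rewrite ler_wpM2l// ltW.
  by rewrite addr_ge0 ?invr_ge0 ?(ltW cKg0)// mulr_ge0 ?sqr_ge0//
    !mulr_ge0//; exact: ltW.
have CL0 : 0 <= `|CKg| / Lg by rewrite divr_ge0// ltW.
rewrite /continuity_constant.
have -> : Cinv * h^-1 * Num.sqrt tau / Num.sqrt Lg = Cinv * s / Num.sqrt Lg.
  by rewrite /s -!mulrA (mulrCA h^-1).
have mixedL : Cinv * s / Num.sqrt Lg <= (Cinv + cKg^-1) / Num.sqrt Lg * X.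
  by rewrite [leRHS]mulrAC ler_wpM2r ?invr_ge0 ?sqrtr_ge0.
have first_le : `|CKg| / Lg <= `|CKg| / Lg * X by rewrite ler_peMr.
move: mixedL first_le X2 Xge1 => /=.
move: (Cinv * s / Num.sqrt Lg) ((Cinv + cKg^-1) / Num.sqrt Lg) (`|CKg| / Lg).
move: (beta * tau) (X) => b Y m q r; lra.
Qed.

(** Since (1 + beta tau)^2 is at least one, the sharper bound implies the form
in which the result is claimed. *)
Lemma DD_matrix_cond_le : A \in unitmx /\ cond A <=
  (Cmu / cmu) ^+ 2 * (`|CKg| / Lg + 4 + 2 * ((Cinv + cKg^-1) / Num.sqrt Lg)) *
  (6 * (1 + beta * tau) ^+ 2 *
   Num.max (1 + Cinv * cKg * tau * h ^- 2) (1 + beta * tau)).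
Proof.
have [Au condA] := DD_matrix_cond; split=> //; apply: (le_trans condA).
rewrite -mulrA ler_wpM2l ?sqr_ge0//; apply: le_trans continuity_constant_le _.
have bt0 : 0 <= beta * tau by rewrite ltW// mulr_gt0.
rewrite ler_wpM2l//.
  by rewrite !addr_ge0// mulr_ge0// ?invr_ge0 ?(ltW Lg0)// mulr_ge0 ?invr_ge0 ?sqrtr_ge0//
    addr_ge0 ?invr_ge0// ltW.
rewrite ler_peMl//; first by rewrite le_max [X in _ || X]addr_ge0 ?orbT.
have := sqr_ge0 (beta * tau); nra.
Qed.

End domain_decomposition_matrix.

(* The dimension of the ambient space is d = n.+1. *)
Theorem theorem5p9 (R : realType) (n : nat) (hn : n = 1%N \/ n = 2%N)
  (G : @geometry R n) (hG : fractured_domain G)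
  (K : 'rV[R]_n.+1 -> 'M[R]_n.+1) (Kg : 'rV[R]_n.+1 -> 'M[R]_n)
  (cK CK cKg CKg : R) (cK0 : 0 < cK) (cKg0 : 0 < cKg)
  (hK : tensor_bounds (leb R n) (Om G ord0 `|` Om G ord_max) K cK CK)
  (hKg : tensor_bounds (surf R n) (gam G) Kg cKg CKg)
  (Lg : R) (Lg0 : 0 < Lg)
  (rho CQ CdTr Cinv cmu Cmu : R) (rho0 : 0 < rho) (CQ0 : 0 < CQ)
  (CdTr0 : 0 < CdTr) (Cinv0 : 0 < Cinv) (cmu0 : 0 < cmu) (Cmu0 : 0 < Cmu) :
  (exists C : R, 0 < C /\
    forall (Th : 'I_2 -> mesh R n.+1 n.+1) (Tg : mesh R n n.+1) (tau alpha : R)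
      (N : nat) (e : 'I_N -> vfield Tg * sfield Tg) (A : 'M[R]_N),
    admissible_meshes G Th Tg rho CQ CdTr Cinv ->
    0 < tau -> 0 < alpha ->
    is_basis G e -> norm_equivalence G Th e Kg Lg tau cmu Cmu ->
    is_DD_matrix G Th e K Kg Lg alpha^-1 tau A ->
    let h := hmax Th Tg in
    A \in unitmx /\
    cond A <= C * (6 * (1 + tau * alpha) ^+ 2 *
      Num.max (1 + Cinv * cKg * tau * h ^- 2) (1 + alpha * tau)))
  /\
  (exists C : R, 0 < C /\
    forall (Th : 'I_2 -> mesh R n.+1 n.+1) (Tg : mesh R n n.+1) (tau : R)
      (N : nat) (e : 'I_N -> vfield Tg * sfield Tg) (A : 'M[R]_N),
    admissible_meshes G Th Tg rho CQ CdTr Cinv ->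
    0 < tau ->
    is_basis G e -> norm_equivalence G Th e Kg Lg tau cmu Cmu ->
    is_DD_matrix G Th e K Kg Lg 0 tau A ->
    let h := hmax Th Tg in
    A \in unitmx /\
    cond A <= C * (6 * (1 + CdTr ^+ 2 * cK^-1 * tau * h^-1) ^+ 2 *
      Num.max (1 + Cinv * cKg * tau * h ^- 2)
              (1 + CdTr ^+ 2 * cK^-1 * tau * h^-1))).

Proof.
set C := (Cmu / cmu) ^+ 2 * (`|CKg| / Lg + 4 + 2 * ((Cinv + cKg^-1) / Num.sqrt Lg)).
have C0 : 0 < C.
  rewrite mulr_gt0 ?exprn_gt0 ?divr_gt0// -addrA ltr_wpDl ?divr_ge0 ?(ltW Lg0)//.
  rewrite ltr_wpDr// mulr_ge0// divr_ge0 ?sqrtr_ge0// addr_ge0 ?invr_ge0//; exact: ltW.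
split; exists C; split=> // Th Tg tau.
  move=> alpha N e A hadm tau0 alpha0 basis_e equiv_e DD_A h.
  have ralpha0 : 0 <= alpha^-1 by rewrite invr_ge0 ltW.
  have energy i (u : vfield (Th i)) : RT0 (Om G i) u ->
      l2norm (surf R n) (gam G) (normal_trace G u) ^+ 2 <=
      alpha * a_bulk G K alpha^-1 u u.
    move=> uRT; rewrite -ler_pdivrMl//.
    apply: le_trans (a_bulk_lower hG hadm hK _ uRT).
    by rewrite lerDr mulr_ge0 ?sqr_ge0// ltW.
  rewrite [tau * alpha]mulrC.
  exact: (DD_matrix_cond_le hG hadm Cinv0 hKg cKg0 Lg0 tau0 cmu0 basis_e
    equiv_e cK0 hK ralpha0 alpha0 energy DD_A).
move=> N e A hadm tau0 basis_e equiv_e DD_A h.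
have h0 : 0 < h by exact: (hmax_gt0 hG hadm).
have area := fracture_area_lty hG hadm hKg cKg0 Lg0 tau0 basis_e equiv_e.
set beta := CdTr ^+ 2 * cK^-1 * h^-1.
have beta0 : 0 < beta by rewrite !mulr_gt0 ?invr_gt0// exprn_gt0.
have energy i (u : vfield (Th i)) : RT0 (Om G i) u ->
    l2norm (surf R n) (gam G) (normal_trace G u) ^+ 2 <=
    beta * a_bulk G K 0 u u.
  move=> uRT; apply: le_trans (trace_inequality hG hadm area CdTr0 uRT) _.
  have := a_bulk_lower hG hadm hK 0 uRT; rewrite mul0r addr0 => low.
  have -> : beta * a_bulk G K 0 u u = CdTr ^+ 2 * h^-1 * (cK^-1 * a_bulk G K 0 u u).
    by rewrite /beta; ring.
  rewrite ler_wpM2l ?ler_pdivlMl//.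
  by rewrite mulr_ge0 ?sqr_ge0 ?invr_ge0// ltW.
have -> : CdTr ^+ 2 * cK^-1 * tau * h^-1 = beta * tau by rewrite /beta mulrAC.
exact: (DD_matrix_cond_le hG hadm Cinv0 hKg cKg0 Lg0 tau0 cmu0 basis_e
  equiv_e cK0 hK (lexx 0) beta0 energy DD_A).
Qed.
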